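(* Let $G$ be a finite non-Engel group. Then the Engel graph $\mathcal{E}_G$ is planar if and only if $G$ is isomorphic to one of the following groups: $S_3$, $D_{12}$, or $T=\langle x,y \mid x^6=x^3y^{-2}=x^yx=1\rangle$.
   Context: For elements of a group, $x^y=y^{-1}xy$, $[x,y]=x^{-1}y^{-1}xy$, and $[x,_k y]$ is defined by $[x,_0 y]=x$, $[x,_k y]=[[x,_{k-1}y],y]$ for $k\ge 1$. An element $x\in G$ is left Engel if for every $a\in G$ there is a positive integer $k$ with $[a,_k x]=1$; $L(G)$ is the set of left Engel elements of $G$. $G$ is an Engel group if $L(G)=G$, and non-Engel otherwise. For a non-Engel group $G$, the Engel graph $\mathcal{E}_G$ is the simple graph with vertex set $G\setminus L(G)$ in which two distinct vertices $x,y$ are adjacent iff $[x,_k y]\neq 1$ and $[y,_k x]\neq 1$ for all positive integers $k$. A planar graph is a graph which can be drawn in the plane so that its edges intersect only at end vertices. $S_3$ is the symmetric group of degree 3 and $D_{12}=\langle s,r\mid s^6=r^2=s^rs=1\rangle$ is the dihedral group of order 12. *)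

(* Defs.v *)
From HB Require Import structures.
From mathcomp Require Import all_boot all_order all_algebra.
From mathcomp Require Import all_fingroup all_solvable.
From mathcomp Require Import all_classical all_reals all_analysis.
Import numFieldNormedType.Exports.

Set Implicit Arguments.
Unset Strict Implicit.
Unset Printing Implicit Defensive.

Section Engel.
Local Open Scope group_scope.
Variable gT : finGroupType.
Implicit Types (x y a : gT) (k : nat) (G : {group gT}).

(* [x,_k y]; mathcomp's x ^ y and [~ x, y] are y^-1 x y and x^-1 y^-1 x y. *)
Fixpoint engel_comm x y k : gT :=
  if k is k'.+1 then [~ engel_comm x y k', y] else x.

Definition is_left_engel G x : Prop :=
  forall a, a \in G -> exists k, (0 < k)%N /\ engel_comm a x k = 1.

Definition left_engel_set G : {set gT} := [set x in G | `[< is_left_engel G x >]].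

Definition engel_group G : Prop := left_engel_set G = G :> {set gT}.

End Engel.

Record sgraph := SGraph {
  svertex :> finType;
  sedge : rel svertex;
  sedge_sym : symmetric sedge;
  sedge_irr : irreflexive sedge
}.

Section EngelGraph.
Local Open Scope group_scope.
Variables (gT : finGroupType) (G : {group gT}).

Definition engel_vertex : finType := {x : gT | x \in G :\: left_engel_set G}.

Definition engel_adj : rel engel_vertex := fun u v =>
  (u != v) &&
  `[< forall k, (0 < k)%N ->
        engel_comm (val u) (val v) k <> 1 /\
        engel_comm (val v) (val u) k <> 1 >].

Lemma engel_adj_sym : symmetric engel_adj.
Proof.
move=> u v; rewrite /engel_adj eq_sym; congr (_ && _).
by apply/asboolP/asboolP => H k k0; have [] := H k k0.
Qed.

Lemma engel_adj_irr : irreflexive engel_adj.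
Proof. by move=> u; rewrite /engel_adj eqxx. Qed.

Definition engel_graph : sgraph := SGraph engel_adj_sym engel_adj_irr.

End EngelGraph.

Section Planarity.
Local Open Scope classical_set_scope.
Local Open Scope ring_scope.
Variable R : realType.

(* A is a simple arc in the plane R * R with end points a and b. *)
Definition is_arc (A : set (R * R)) (a b : R * R) : Prop :=
  exists c : R -> R * R,
    [/\ {within `[0, 1], continuous c}, set_inj `[0, 1] c,
        c 0 = a, c 1 = b & c @` `[0, 1] = A].

(* The edge joining x and y is the unordered pair [set x; y]%SET, so each edge
   is drawn as a single arc; values of arc off the edges are irrelevant. *)
Record plane_drawing (g : sgraph) (pt : g -> R * R)
    (arc : {set g} -> set (R * R)) : Prop := PlaneDrawing {
  drawing_inj : injective pt;
  drawing_arc : forall x y : g, sedge x y ->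
    is_arc (arc [set x; y]%SET) (pt x) (pt y);
  drawing_vertex : forall x y z : g, sedge x y ->
    arc [set x; y]%SET (pt z) -> z = x \/ z = y;
  drawing_edges : forall x y x' y' : g, sedge x y -> sedge x' y' ->
    [set x; y]%SET != [set x'; y']%SET ->
    forall p, arc [set x; y]%SET p -> arc [set x'; y']%SET p ->
    exists z : g, [/\ z \in [set x; y]%SET, z \in [set x'; y']%SET & p = pt z]
}.

Definition planar (g : sgraph) : Prop :=
  exists (pt : g -> R * R) (arc : {set g} -> set (R * R)), plane_drawing pt arc.

End Planarity.

(* Main.v *)
Require Import Defs.
From mathcomp Require Import all_boot all_fingroup all_solvable all_reals.
From mathcomp Require all_order all_algebra all_classical all_analysis.
From mathcomp Require lra ring zify.
From Stdlib Require Btauto.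

(** Two elements of a finite group [G] that are adjacent in its Engel graph
    generate a non-nilpotent subgroup, and a non-nilpotent group produces many
    adjacent pairs.  The proof finds K33 or K5 in the Engel graph of every
    non-nilpotent group other than the three of the statement.

    Nonplanarity of K33 and K5.  Let two disjoint arcs [a] and [b] be given.
    The map [(s, t) |-> a s - b t] on the unit square avoids 0, so the image of
    the boundary of the square does not wind around 0; hence it meets the open
    positive half-axis an even number of times.  On a fine grid this is an
    identity between finite sums of bits ([disjoint_arcs_parity]), and it only
    needs uniform continuity and a positive distance between the arcs.  Each
    side of the square is one of the arcs seen from an end point of the other.
    A drawing thus gives, for each pair of disjoint edges, one linear equation
    over the field with two elements ([drawing_parity]).  In the sum over all
    such pairs, for K33 or for K5, every unknown occurs an even number of times,
    whereas the sum of the constants is 1.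

    Groups whose Engel graph contains neither K33 nor K5.  To see that
    [[x,_k y]] never vanishes, it suffices to trap these commutators in a set
    that misses 1 ([engel_comm_neq1]).  Three such traps are used.
    - If a Sylow [p]-subgroup is not normal, let [D] be an intersection of two
      Sylow [p]-subgroups of maximal order.  The Sylow [p]-subgroups of [N_G(D)]
      meet pairwise in [D], and elements outside [D] of two of them are adjacent.
      For odd [p] there are at least four of them, with at least two such
      elements each, which gives K33.  So the Sylow subgroups of odd order are
      normal, and [G = H ><| Q] with [H] nilpotent of odd order and [Q] a
      2-group; some [z] in [Q] does not centralize [H].
    - The conjugates of [z] under [H] are pairwise adjacent, because the action
      is coprime.  Without K5 there are at most four, hence exactly three.
    - If [D] is normal in [X], [X / D] is abelian and [z] acts on it without
      fixed points, then [z * a] and [z * b] are adjacent as soon as [a] and [b]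
      lie in distinct cosets of [D]; without K33 this forces [#|D| <= 2].  With
      [X = H] and [D = 'C_H[z]] it yields [#|H| = 3], and with [X = 'C_G(H)] and
      [D = 'C_Q(H)] it yields [#|G| = 6] or [#|G| = 12].
    Reading off generators leaves [x], [y] with [x ^ y = x^-1], [x ^+ n = 1] and
    [y ^+ 2 = x ^+ k], where [#|G| = 2n] and [(n, k)] is [(3, 0)], [(6, 0)] or
    [(6, 3)].  Such a group is determined by these relations
    ([dihedral_like_homg]).

    Planarity of the three graphs.  In each case [x ^+ 6 = 1], the elements of
    [<[x]>] are left Engel, and [x ^+ i * y] commutes with [x ^+ j * y] when [i]
    and [j] are congruent modulo 3.  So the Engel graph is contained in the
    octahedron, which has a straight-line drawing. *)

Module PlaneGraphs.
Import all_order all_algebra all_classical all_reals all_analysis.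
Import lra ring zify Btauto.
Import Order.TTheory GRing.Theory Num.Theory.
Import numFieldNormedType.Exports.
Set Implicit Arguments.
Unset Strict Implicit.
Unset Printing Implicit Defensive.
Local Open Scope classical_set_scope.
Local Open Scope ring_scope.

(** * Crossing parities of sampled curves *)

Section Crossing.
Variable R : realType.
Implicit Types p q r s : R * R.

(** The open lower half-plane with the open left half-axis added, so that exactly
    one of [p] and [- p] satisfies it when [p != 0]. *)
Definition lex_neg p := (p.2 < 0) || ((p.2 == 0) && (p.1 < 0)).
(** For a short segment away from 0, whether it meets the right half-axis. *)
Definition crosses_ray p q := (lex_neg p != lex_neg q) && (0 < p.1).

Lemma normp_lt p d : (`|p| < d) = (`|p.1| < d) && (`|p.2| < d).
Proof. by rewrite [X in X < _]/Num.norm/= gt_max. Qed.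

Lemma normp_ge p d : (d <= `|p|) = (d <= `|p.1|) || (d <= `|p.2|).
Proof. by rewrite [X in _ <= X]/Num.norm/= le_max. Qed.

Lemma lex_negN p : p != 0 -> lex_neg (- p) = ~~ lex_neg p.
Proof.
case: p => x y; rewrite /lex_neg/= oppr_lt0 oppr_eq0 oppr_lt0 => nz.
have [//|//|y0] := ltgtP y 0; rewrite /=.
have : x != 0 by apply: contraNneq nz => ->; rewrite y0.
by case: ltgtP.
Qed.

(** When the ends of a short segment lie in different halves, the segment is close
    to the horizontal axis; being away from 0, it is far from the vertical axis,
    and every point [r] near it is on the same side of that axis. *)
Lemma lex_neg_neq_sides p q r d : 2 * d <= `|p| -> 2 * d <= `|r| ->
  `|p - q| < d -> `|p - r| < d -> lex_neg p != lex_neg q ->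
  (0 < p.1) = (0 < r.1) /\ p.1 != 0.
Proof.
case: p q r => [px py] [qx qy] [rx ry].
rewrite !normp_ge !normp_lt /lex_neg/= => hp hr /andP[h1 h2] /andP[h3 h4] hl.
have d0 : 0 < d by apply: le_lt_trans h1.
(* Zero lies between the second coordinates of p and q. *)
have hy : `|py| < d.
  case: (ltgtP py 0) hl => py0; case: (ltgtP qy 0) => qy0 //= _;
  move: h2; rewrite ?py0 ?normr0 // !ltr_norml => /andP[? ?]; apply/andP; split; lra.
have hx : 2 * d <= `|px| by case/orP: hp => // ?; lra.
move: h3; rewrite ltr_norml => /andP[? ?].
case: (ltgtP px 0) hx => px0; rewrite ?(ltr0_norm px0) ?(gtr0_norm px0) => hx.
- by split => //; apply/esym/negbTE; rewrite -leNgt; lra.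
- by split => //; apply/esym; lra.
- by move: hx; rewrite px0 normr0; lra.
Qed.

(** Around a small cell away from 0 the half changes an even number of times.  If
    it changes at all, the whole cell is on one side of the vertical axis, so that
    either every change is a crossing of the right half-axis or none is. *)
Lemma crosses_ray_cell p q r s d :
  2 * d <= `|p| -> 2 * d <= `|q| -> 2 * d <= `|s| ->
  `|p - q| < d -> `|p - r| < d -> `|p - s| < d ->
  crosses_ray p q (+) crosses_ray q r (+) crosses_ray s r (+) crosses_ray p s = false.
Proof.
move=> fp fq fs pq pr ps; rewrite /crosses_ray.
have [/= lpq|/negPn/eqP <-] := boolP (lex_neg p != lex_neg q).
  have [<- _] := lex_neg_neq_sides fp fq pq pq lpq.
  have [<- _] := lex_neg_neq_sides fp fs pq ps lpq.
  case: (0 < p.1); rewrite ?andbF// !andbT.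
  by move: (lex_neg p) (lex_neg q) (lex_neg r) (lex_neg s) lpq => [] [] [] [].
have [/= lpr|/negPn/eqP <-] := boolP (lex_neg p != lex_neg r).
  have [<- _] := lex_neg_neq_sides fp fq pr pq lpr.
  have [<- _] := lex_neg_neq_sides fp fs pr ps lpr.
  case: (0 < p.1); rewrite ?andbF// !andbT.
  by move: (lex_neg p) (lex_neg r) (lex_neg s) lpr => [] [] [].
have [/= lps|/negPn/eqP <-] := boolP (lex_neg p != lex_neg s); last by rewrite ?eqxx.
rewrite ?eqxx/=; have [<- _] := lex_neg_neq_sides fp fs ps ps lps.
case: (0 < p.1); rewrite ?andbF// !andbT.
by move: (lex_neg p) (lex_neg s) lps => [] [].
Qed.

(** A change of half that does not cross the right half-axis crosses the left one. *)
Lemma crosses_rayN p q d : 2 * d <= `|p| -> 2 * d <= `|q| -> `|p - q| < d ->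
  crosses_ray (- p) (- q) = crosses_ray p q (+) lex_neg p (+) lex_neg q.
Proof.
move=> fp fq pq; have d0 : 0 < d by apply: le_lt_trans pq.
have [p0 q0] : p != 0 /\ q != 0 by rewrite -!normr_gt0; split; lra.
rewrite /crosses_ray !lex_negN// oppr_gt0.
have [/= lpq|/negPn/eqP <-] := boolP (lex_neg p != lex_neg q); last by case: (lex_neg p).
have [_ +] := lex_neg_neq_sides fp fq pq pq lpq.
by move: (lex_neg p) (lex_neg q) lpq => [] [] //= _; case: (ltgtP p.1 0).
Qed.

Lemma telescope_addb (f : nat -> bool) n :
  \big[addb/false]_(i < n) (f i (+) f i.+1) = f 0%N (+) f n.
Proof.
elim: n => [|n IH]; first by rewrite big_ord0 addbb.
by rewrite big_ord_recr/= IH -addbA (addbA (f n)) addbb addFb.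
Qed.

Definition ray_parity (f : nat -> R * R) n :=
  \big[addb/false]_(i < n) crosses_ray (f i) (f i.+1).

(** Discrete form of the fact that the boundary of a square mapped to the punctured
    plane does not wind around 0: the cells of a grid are summed, and each inner
    side occurs twice. *)
Lemma ray_parity_grid (F : nat -> nat -> R * R) m n d :
  (forall i j, (i <= m)%N -> (j <= n)%N -> 2 * d <= `|F i j|) ->
  (forall i j i' j', (i <= i' <= i.+1)%N -> (i' <= m)%N ->
     (j <= n)%N -> (j' <= n)%N -> (j <= j'.+1)%N -> (j' <= j.+1)%N -> `|F i j - F i' j'| < d) ->
  ray_parity (F^~ 0%N) m (+) ray_parity (F^~ n) m (+)
  ray_parity (F 0%N) n (+) ray_parity (F m) n = false.
Proof.
move=> far close.
have cell i j : (i < m)%N -> (j < n)%N ->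
    crosses_ray (F i j) (F i.+1 j) (+) crosses_ray (F i j.+1) (F i.+1 j.+1) =
    crosses_ray (F i j) (F i j.+1) (+) crosses_ray (F i.+1 j) (F i.+1 j.+1).
  move=> im jn.
  suff : crosses_ray (F i j) (F i.+1 j) (+) crosses_ray (F i.+1 j) (F i.+1 j.+1) (+)
         crosses_ray (F i j.+1) (F i.+1 j.+1) (+) crosses_ray (F i j) (F i j.+1) = false.
    by do 4! case: (crosses_ray _ _).
  by apply: (@crosses_ray_cell _ _ _ _ d); [apply: far; lia..|apply: close; lia|
    apply: close; lia|apply: close; lia].
have row j : (j < n)%N -> ray_parity (F^~ j) m (+) ray_parity (F^~ j.+1) m =
    crosses_ray (F 0%N j) (F 0%N j.+1) (+) crosses_ray (F m j) (F m j.+1).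
  move=> jn; rewrite -(telescope_addb (fun i => crosses_ray (F i j) (F i j.+1))).
  rewrite /ray_parity -big_split/=; apply: eq_bigr => i _; exact: cell.
rewrite -(telescope_addb (fun j => ray_parity (F^~ j) m)) -addbA.
rewrite [in X in _ (+) X]/ray_parity -big_split/=.
rewrite (eq_bigr _ (fun (i : 'I_n) _ => row i (ltn_ord i))).
by rewrite addbb.
Qed.

End Crossing.

(** * Disjoint arcs *)

Local Notation unit_itv R := (`[(0 : R), 1]%classic : set R).

Section Sampling.
Variable R : realType.

(** A compactness principle that covers both uniform continuity and the positive
    distance between disjoint compact sets. *)
Lemma compact_uniform (X : pseudoMetricType R) (K : set X) (P : R -> X -> Prop) :
  compact K -> (forall e e' x, e' <= e -> P e x -> P e' x) ->
  (forall x, K x -> exists2 e, 0 < e & forall y, K y -> ball x e y -> P e y) ->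
  exists2 e, 0 < e & forall x, K x -> P e x.
Proof.
move=> /compact_near_coveringP/near_covering_withinP cK Pmono Ploc.
have : \forall e \near (0 : R)^'+, K `<=` P e.
  apply: cK => x Kx; have [e e0 eP] := Ploc x Kx.
  exists (ball x e, [set e' | e' <= e]) => /=.
    by split; [exact: nbhsx_ballx | exact: nbhs_right_le].
  by case=> y e' /= [xy e'e] Ky; apply: Pmono e'e _; exact: eP.
move=> near0; have [e [? ?]] : exists e : R, 0 < e /\ K `<=` P e.
  near (0 : R)^'+ => e; exists e; split; near: e => //.
  exact: nbhs_right_gt.
by exists e.
Unshelve. all: by end_near. Qed.

Variables (c : R -> R * R).
Hypothesis ccont : {within `[0, 1], continuous c}.

Lemma arc_continuousP (s d : R) : unit_itv R s -> 0 < d ->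
  exists2 e, 0 < e & forall t, unit_itv R t -> `|s - t| < e -> `|c s - c t| < d.
Proof.
move=> s01 d0; have /cvgrPdist_lt/(_ _ d0) := iffLR (subspace_continuousP _ _) ccont s s01.
move=> /nbhs_ballP[e /= e0 eP]; exists e => // t t01 st.
exact: eP.
Qed.

Lemma arc_uniform_continuity (d : R) : 0 < d ->
  exists2 e, 0 < e & forall s t : R, unit_itv R s -> unit_itv R t ->
    `|s - t| < e -> `|c s - c t| < d.
Proof.
move=> d0.
have [||e e0 eP] := @compact_uniform R (unit_itv R) (fun e s => forall t,
    unit_itv R t -> `|s - t| < e -> `|c s - c t| < d) (@segment_compact R 0 1).
- by move=> e e' s ee' + t t01 st; apply => //; exact: lt_le_trans ee'.
- move=> s s01; have d2 : 0 < d / 2 by lra.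
  have [e e0 eP] := arc_continuousP s01 d2.
  exists (e / 2); first by lra.
  move=> t t01; rewrite /ball/= => st u u01 tu.
  rewrite -(subrKA (c s)) (splitr d); apply: (le_lt_trans (ler_normD _ _)).
  apply: ltrD; first by rewrite distrC; apply: eP => //; lra.
  apply: eP => //; rewrite -(subrKA t) (splitr e).
  by apply: (le_lt_trans (ler_normD _ _)); apply: ltrD.
by exists e => // s t s01 t01; exact: eP.
Qed.

End Sampling.

Lemma disjoint_arcs_dist (R : realType) (a b : R -> R * R) :
  {within `[0, 1], continuous a} -> {within `[0, 1], continuous b} ->
  (forall s t : R, unit_itv R s -> unit_itv R t -> a s != b t) ->
  exists2 d, 0 < d & forall s t : R, unit_itv R s -> unit_itv R t ->
    d <= `|a s - b t|.
Proof.
move=> ca cb ab.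
have [||e e0 eP] := @compact_uniform R (R * R)%type (unit_itv R `*` unit_itv R)
    (fun e st => e <= `|a st.1 - b st.2|)
    (compact_setX (@segment_compact R 0 1) (@segment_compact R 0 1)).
- by move=> e e' x; exact: le_trans.
- case=> s t [/= s01 t01]; pose d := `|a s - b t|.
  have d0 : 0 < d by rewrite normr_gt0 subr_eq0 ab.
  have d4 : 0 < d / 4 by lra.
  have [e e0 eP] := arc_continuousP ca s01 d4.
  have [f f0 fP] := arc_continuousP cb t01 d4.
  exists (Num.min (d / 2) (Num.min e f)).
    by rewrite !lt_min e0 f0 !andbT; lra.
  case=> s' t' [/= s'01 t'01] [/=]; rewrite /ball/= !lt_min.
  move=> /and3P[_ /(eP _ s'01) ss' _] /and3P[_ _ /(fP _ t'01) tt'].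
  rewrite ge_min; apply/orP; left.
  have : d <= `|a s - a s'| + `|a s' - b t'| + `|b t - b t'|.
    rewrite (distrC (b t)) /d; have -> : a s - b t = (a s - a s') + (a s' - b t') + (b t' - b t).
      by rewrite !subrKA.
    by apply: (le_trans (ler_normD _ _)); rewrite lerD2r ler_normD.
  by lra.
by exists e => // s t s01 t01; apply: (eP (s, t)).
Qed.

Section Parity.
Variable R : realType.

Definition sample (c : R -> R * R) (n i : nat) : R * R := c (i%:R / n%:R).

Lemma sample01 (n i : nat) : (0 < n)%N -> (i <= n)%N -> unit_itv R (i%:R / n%:R : R).
Proof.
move=> n0 i_n; rewrite /= in_itv/= divr_ge0//= ler_pdivrMr ?ltr0n//.
by rewrite mul1r ler_nat.
Qed.

Lemma sample_close (n i j : nat) e : (0 < n)%N -> 1 / n%:R < e ->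
  (i <= j.+1)%N -> (j <= i.+1)%N -> `|i%:R / n%:R - j%:R / n%:R| < e :> R.
Proof.
move=> n0 ne ij ji; apply: le_lt_trans ne.
have n0' : 0 < n%:R :> R by rewrite ltr0n.
rewrite -mulrBl normrM normfV [`|n%:R|]ger0_norm ?ler0n//.
rewrite ler_pM2r ?invr_gt0// ler_norml.
move: ij ji; rewrite -(ler_nat R) -natr1 -(ler_nat R j) -natr1 => ? ?.
by apply/andP; split; lra.
Qed.

Lemma ray_parity_opp (c : nat -> R * R) (p : R * R) (n : nat) (d : R) :
  (forall i, (i <= n)%N -> 2 * d <= `|c i - p|) ->
  (forall i, (i < n)%N -> `|c i - c i.+1| < d) ->
  ray_parity (fun i => p - c i) n =
  ray_parity (fun i => c i - p) n (+) (lex_neg (c 0%N - p) (+) lex_neg (c n - p)).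
Proof.
move=> far close.
rewrite -(telescope_addb (fun i => lex_neg (c i - p))) /ray_parity -big_split/=.
apply: eq_bigr => i _; rewrite -(opprB (c i)) -(opprB (c i.+1)).
rewrite (@crosses_rayN _ _ _ d) ?addbA//.
- by apply: far; exact: ltnW.
- exact: far.
- by rewrite opprB subrKA; exact: close.
Qed.

(** Crossings, modulo 2, of the [n]-th polygonal sample of [c] with the horizontal
    ray that starts at [p] and goes to the right. *)
Definition arc_parity c n (p : R * R) := ray_parity (fun i => sample c n i - p) n.

(** The identity of [ray_parity_grid] for the map [(s, t) |-> a s - b t].  On the two
    sides of the square where [b] moves, the sign is changed back by
    [ray_parity_opp], which produces the terms on the right. *)
Lemma disjoint_arcs_parity (a b : R -> R * R) :
  {within `[0, 1], continuous a} -> {within `[0, 1], continuous b} ->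
  (forall s t : R, unit_itv R s -> unit_itv R t -> a s != b t) ->
  exists n0 : nat, forall n, (n0 <= n)%N ->
    arc_parity a n (b 0) (+) arc_parity a n (b 1) (+)
    (arc_parity b n (a 0) (+) arc_parity b n (a 1)) =
    lex_neg (b 0 - a 0) (+) lex_neg (b 1 - a 0) (+)
    (lex_neg (b 0 - a 1) (+) lex_neg (b 1 - a 1)).
Proof.
move=> ca cb ab.
have [d4 d40 dP] := disjoint_arcs_dist ca cb ab.
(* Corners of a grid cell are within 2 d of each other and at least 4 d away
   from 0, as the lemmas on cells require. *)
pose d := d4 / 4; have d0 : 0 < d by rewrite /d; lra.
have [e e0 eP] := arc_uniform_continuity ca d0.
have [f f0 fP] := arc_uniform_continuity cb d0.
pose h := Num.min e f; have h0 : 0 < h by rewrite lt_min e0.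
exists (Num.truncn h^-1).+1 => n n0n.
have n0 : (0 < n)%N by exact: leq_trans n0n.
have n0' : 0 < n%:R :> R by rewrite ltr0n.
have : 1 / n%:R < h.
  rewrite div1r -[h]invrK ltf_pV2 ?posrE ?invr_gt0//.
  by apply: lt_le_trans (truncnS_gt _) _; rewrite ler_nat.
rewrite lt_min => /andP[ne nf].
have a0 c : sample c n 0 = c 0 by rewrite /sample mul0r.
have a1 c : sample c n n = c 1 by rewrite /sample divff// lt0r_neq0.
have far i j : (i <= n)%N -> (j <= n)%N -> 2 * (2 * d) <= `|sample a n i - sample b n j|.
  move=> ? ?; apply: le_trans (dP _ _ (sample01 _ _) (sample01 _ _)) => //.
  by rewrite /d; lra.
have sa i j : (i <= n)%N -> (j <= n)%N -> (i <= j.+1)%N -> (j <= i.+1)%N ->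
    `|sample a n i - sample a n j| < d.
  by move=> ? ? ? ?; apply: eP; [exact: sample01..|exact: sample_close].
have sb i j : (i <= n)%N -> (j <= n)%N -> (i <= j.+1)%N -> (j <= i.+1)%N ->
    `|sample b n i - sample b n j| < d.
  by move=> ? ? ? ?; apply: fP; [exact: sample01..|exact: sample_close].
have grid : ray_parity (fun i => sample a n i - b 0) n (+)
    ray_parity (fun i => sample a n i - b 1) n (+)
    ray_parity (fun j => a 0 - sample b n j) n (+)
    ray_parity (fun j => a 1 - sample b n j) n = false.
  rewrite -!a0 -!a1.
  apply: (@ray_parity_grid _ (fun i j => sample a n i - sample b n j) n n (2 * d)).
    by move=> i j; exact: far.
  move=> i j i' j' /andP[ii' i'i] ? ? ? ? ?.
  have -> : sample a n i - sample b n j - (sample a n i' - sample b n j') =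
    (sample a n i - sample a n i') + (sample b n j' - sample b n j).
    by rewrite opprB addrACA [RHS]addrACA; congr (_ + _); rewrite addrC.
  apply: (le_lt_trans (ler_normD _ _)).
  have -> : 2 * d = d + d by lra.
  have ? := leq_trans ii' (leqnSn i').
  by apply: ltrD; [apply: sa => //; exact: leq_trans ii' _|apply: sb].
have opp i : (i <= n)%N -> ray_parity (fun j => sample a n i - sample b n j) n =
    ray_parity (fun j => sample b n j - sample a n i) n (+)
    (lex_neg (b 0 - sample a n i) (+) lex_neg (b 1 - sample a n i)).
  move=> i_n; rewrite -(a0 b) -(a1 b); apply: (@ray_parity_opp _ _ _ (2 * d)) => j j_n.
    by rewrite distrC; exact: far.
  apply: (@lt_trans _ _ d); last by lra.
  by apply: sb => //; exact: ltnW.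
have := opp 0%N (leq0n n); have := opp n (leqnn n); rewrite !a0 !a1 => oppn opp0.
move: grid; rewrite oppn opp0 /arc_parity.
move: (ray_parity _ _) (ray_parity _ _) (ray_parity _ _) (ray_parity _ _).
move: (lex_neg _) (lex_neg _) (lex_neg _) (lex_neg _).
by do 8! case.
Qed.

End Parity.

(** * The complete graphs K33 and K5 are not planar *)

Lemma addbxorb : addb =2 xorb.
Proof. by case; case. Qed.

Lemma sedge_neq (g : sgraph) (x y : g) : sedge x y -> x != y.
Proof. by apply: contraTneq => ->; rewrite sedge_irr. Qed.

Section NonPlanar.
Variables (R : realType) (g : sgraph).

Lemma edge_ends (u v x y : g) : sedge u v -> [set u; v]%SET = [set x; y]%SET ->
  (u = x /\ v = y) \/ (u = y /\ v = x).
Proof.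
move=> uv e; have : u \in [set x; y]%SET by rewrite -e set21.
have : v \in [set x; y]%SET by rewrite -e set22.
rewrite !inE => /orP[]/eqP vE /orP[]/eqP uE; subst; auto;
  by rewrite sedge_irr in uv.
Qed.

(** Here [w E x] is the crossing parity of the edge [E] with the ray at [x], and [t]
    compares vertices lexicographically.  As there are finitely many edges, one
    sample size suits all pairs of disjoint edges. *)
Lemma drawing_parity (pt : g -> R * R) arc : plane_drawing pt arc ->
  exists (w : {set g} -> g -> bool) (t : g -> g -> bool),
    (forall x y, x != y -> t x y = ~~ t y x) /\
    forall u v x y, sedge u v -> sedge x y ->
    [/\ u != x, u != y, v != x & v != y] ->
    w [set u; v]%SET x (+) w [set u; v]%SET y (+)
    (w [set x; y]%SET u (+) w [set x; y]%SET v) =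
    t x u (+) t y u (+) (t x v (+) t y v).
Proof.
move=> dr.
pose curve_of (E : {set g}) (c : R -> R * R) := forall u v, sedge u v ->
  E = [set u; v]%SET -> [/\ {within `[0, 1], continuous c}, c @` `[0, 1] = arc E &
    (c 0 = pt u /\ c 1 = pt v) \/ (c 0 = pt v /\ c 1 = pt u)].
have /choice[c cP] : forall E, exists c, curve_of E c.
  move=> E; have [[[u v] [/= uv EE]]|noE] := pselect (exists e : g * g,
    sedge e.1 e.2 /\ E = [set e.1; e.2]%SET); last first.
    by exists (fun=> 0) => u v uv EE; case: noE; exists (u, v).
  have [c [cc _ c0 c1 cim]] := drawing_arc dr uv; exists c => u' v' _ E'.
  split; rewrite ?EE//.
  by have [[<- <-]|[<- <-]] := edge_ends uv (etrans (esym EE) E'); auto.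
pose curves_parity (q : (g * g) * (g * g)) (n0 : nat) :=
  sedge q.1.1 q.1.2 -> sedge q.2.1 q.2.2 ->
  [/\ q.1.1 != q.2.1, q.1.1 != q.2.2, q.1.2 != q.2.1 & q.1.2 != q.2.2] ->
  forall n, (n0 <= n)%N ->
  let e := c [set q.1.1; q.1.2]%SET in let f := c [set q.2.1; q.2.2]%SET in
  arc_parity e n (pt q.2.1) (+) arc_parity e n (pt q.2.2) (+)
  (arc_parity f n (pt q.1.1) (+) arc_parity f n (pt q.1.2)) =
  lex_neg (pt q.2.1 - pt q.1.1) (+) lex_neg (pt q.2.2 - pt q.1.1) (+)
  (lex_neg (pt q.2.1 - pt q.1.2) (+) lex_neg (pt q.2.2 - pt q.1.2)).
have /choice[n0 n0P] : forall q, exists n0, curves_parity q n0.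
  move=> [[u v] [x y]]; rewrite /curves_parity/=.
  have [uv|nuv] := boolP (sedge u v); last by exists 0%N.
  have [xy|nxy] := boolP (sedge x y); last by exists 0%N.
  have [dis|ndis] := boolP [&& u != x, u != y, v != x & v != y];
    last by exists 0%N => _ _ [ux uy vx vy]; rewrite ux uy vx vy in ndis.
  case/and4P: dis => ux uy vx vy.
  have notin z : z \in [set u; v]%SET -> z \in [set x; y]%SET -> False.
    by rewrite !inE => /orP[]/eqP-> /orP[]; apply/negP.
  have [cuv uvim uv01] := cP _ _ _ uv erefl.
  have [cxy xyim xy01] := cP _ _ _ xy erefl.
  have [s t s01 t01|n0 n0P] := disjoint_arcs_parity cuv cxy.
    apply/eqP => st.
    have neq : [set u; v]%SET != [set x; y]%SET.
      by apply/eqP => /setP/(_ u); rewrite set21 => /esym/(notin u (set21 _ _)).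
    have puv : arc [set u; v]%SET (c [set u; v]%SET s) by rewrite -uvim; exists s.
    have pxy : arc [set x; y]%SET (c [set u; v]%SET s) by rewrite -xyim st; exists t.
    have [z [zuv zxy _]] := drawing_edges dr uv xy neq puv pxy.
    exact: notin zuv zxy.
  exists n0 => _ _ _ n /n0P H.
  case: uv01 H => -[-> ->]; case: xy01 => -[-> ->] //= H;
    (etransitivity; [|etransitivity; [exact: H|]]; rewrite !addbxorb;
      [move: (arc_parity _ _ _) (arc_parity _ _ _) (arc_parity _ _ _)
        (arc_parity _ _ _)
      |move: (lex_neg _) (lex_neg _) (lex_neg _) (lex_neg _)]; intros; btauto).
pose N := \max_q n0 q.
exists (fun E x => arc_parity (c E) N (pt x)), (fun x u => lex_neg (pt x - pt u)).
split=> [x y xy|u v x y uv xy dis].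
  rewrite -opprB lex_negN// subr_eq0; apply: contraNneq xy => e.
  by apply/eqP/(drawing_inj dr); rewrite e.
exact: (n0P ((u, v), (x, y)) uv xy dis N (leq_bigmax _)).
Qed.

(** The equations of all 18 pairs of disjoint edges are added.  An unknown with [x]
    on the side of an end point [u] of the edge [uv] occurs once for each of the
    two neighbours of [x] other than [v], hence cancels, while the comparisons [t]
    leave 1. *)
Lemma K33_nonplanar (a b : 'I_3 -> g) : injective a -> injective b ->
  (forall i j, sedge (a i) (b j)) -> ~ planar R g.
Proof.
move=> ainj binj ab [pt [arc /drawing_parity[w [t [tN par]]]]].
have abN i j : a i != b j := sedge_neq (ab i j).
pose W i j x := w [set a i; b j]%SET x.
pose P i i' j j' := W i j (a i') (+) W i j (b j') (+)
    (W i' j' (a i) (+) W i' j' (b j)) (+)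
    (t (a i') (a i) (+) t (a i) (b j') (+) (t (a i') (b j) (+) t (b j') (b j))).
have {}par i i' j j' : i != i' -> j != j' -> P i i' j j' = true.
  move=> ii' jj'; rewrite /P /W par//; last first.
    by rewrite ?(inj_eq ainj) ?(inj_eq binj) (eq_sym (b j)) abN.
  rewrite (tN (b j') (a i)); last by rewrite eq_sym.
  by move: (t _ _) (t _ _) (t _ _) (t _ _); do 4! case.
have {tN} tb i j : i != j -> t (b i) (b j) = ~~ t (b j) (b i).
  by move=> ij; apply: tN; rewrite (inj_eq binj).
pose o0 : 'I_3 := @Ordinal 3 0 isT; pose o1 : 'I_3 := @Ordinal 3 1 isT.
pose o2 : 'I_3 := @Ordinal 3 2 isT.
pose Q i i' := P i i' o0 o1 (+) P i i' o0 o2 (+) P i i' o1 o2 (+)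
  P i i' o1 o0 (+) P i i' o2 o0 (+) P i i' o2 o1.
have : Q o0 o1 (+) Q o0 o2 (+) Q o1 o2 = false by rewrite /Q !par.
rewrite /Q /P (tb o0 o1)// (tb o0 o2)// (tb o1 o2)//.
rewrite !addbxorb => E; suff : true = false by []; rewrite -[RHS]E.
do 36! [move: (W _ _ _) => ?]; do 15! [move: (t _ _) => ?].
btauto.
Qed.

(** The equations of all 15 pairs of disjoint edges are added.  The unknown of an edge
    [uv] and a vertex [x] occurs once for each of the two remaining vertices, hence
    cancels.  The three perfect matchings of a set of four vertices leave 1, and
    there are five such sets. *)
Lemma K5_nonplanar (x : 'I_5 -> g) :
  (forall i j, i != j -> sedge (x i) (x j)) -> ~ planar R g.
Proof.
move=> adj [pt [arc /drawing_parity[w [t [tN par]]]]].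
have xN i j : i != j -> x i != x j by move=> ij; exact/sedge_neq/adj.
pose W i j k := w [set x i; x j]%SET (x k).
pose P i j k l := W i j k (+) W i j l (+) (W k l i (+) W k l j) (+)
  (t (x i) (x k) (+) t (x i) (x l) (+) (t (x j) (x k) (+) t (x j) (x l))).
have {}par i j k l : uniq [:: i; j; k; l] -> P i j k l = false.
  rewrite /= !inE !negb_or => /and4P[/and3P[ij ik il] /andP[jk jl] kl _].
  rewrite /P /W par ?adj ?xN//.
  rewrite (tN (x k) (x i)) ?(tN (x k) (x j)) ?(tN (x l) (x i)) ?(tN (x l) (x j));
    try by rewrite eq_sym xN.
  by move: (t _ _) (t _ _) (t _ _) (t _ _); do 4! case.
have {}tN i j : i != j -> t (x i) (x j) = ~~ t (x j) (x i).
  by move=> ij; apply: tN; exact: xN.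
pose o k (lt_k5 : (k < 5)%N) := Ordinal lt_k5.
pose o0 := o 0 isT; pose o1 := o 1 isT; pose o2 := o 2 isT.
pose o3 := o 3 isT; pose o4 := o 4 isT.
pose Q i j k l := P i j k l (+) P i k j l (+) P i l j k.
have : Q o0 o1 o2 o3 (+) Q o0 o1 o2 o4 (+) Q o0 o1 o3 o4 (+) Q o0 o2 o3 o4 (+)
  Q o1 o2 o3 o4 = false by rewrite /Q !par.
rewrite /Q /P.
rewrite (tN o2 o1)// (tN o3 o1)// (tN o3 o2)//.
rewrite (tN o4 o1)// (tN o4 o2)// (tN o4 o3)//.
rewrite !addbxorb => E; suff : true = false by []; rewrite -[RHS]E.
do 30! [move: (W _ _ _) => ?]; do 10! [move: (t _ _) => ?].
btauto.
Qed.

End NonPlanar.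

(** * Straight-line drawings and the octahedron *)

(** A drawing is pulled back along an injective morphism of graphs. *)
Lemma planar_mono (R : realType) (g h : sgraph) (f : g -> h) : injective f ->
  (forall x y, sedge x y -> sedge (f x) (f y)) -> planar R h -> planar R g.
Proof.
move=> finj fadj [pt [arc [pinj parc pvert pedge]]].
have fset2 x y : (f @: [set x; y] = [set f x; f y])%SET by rewrite imsetU1 imset_set1.
exists (pt \o f), (fun E : {set g} => arc (f @: E)%SET); split.
- exact: inj_comp.
- by move=> x y xy /=; rewrite fset2; exact/parc/fadj.
- move=> x y z xy; rewrite fset2 => /(pvert _ _ _ (fadj _ _ xy)).
  by case=> /finj; auto.
- move=> x y x' y' xy x'y' neq p; rewrite !fset2 => pxy px'y'.
  have neq' : [set f x; f y]%SET != [set f x'; f y']%SET.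
    by rewrite -!fset2 (inj_eq (imset_inj finj)).
  have [z [zxy zx'y' pz]] := pedge _ _ _ _ (fadj _ _ xy) (fadj _ _ x'y') neq' _ pxy px'y'.
  rewrite -!fset2 in zxy zx'y'; case/imsetP: zxy => u uxy zu.
  exists u; split=> //=; last by rewrite -zu.
  by move: zx'y'; rewrite zu mem_imset.
Qed.

(** Twice the signed area of the triangle [abc]. *)
Definition orient (T : pzRingType) (a b c : T * T) : T :=
  (b.1 - a.1) * (c.2 - a.2) - (b.2 - a.2) * (c.1 - a.1).

Section StraightLine.
Variable R : realType.
Implicit Types a b c d p : R * R.

Definition segment_path a b (t : R) : R * R := a + t *: (b - a).
Definition segment a b : set (R * R) := segment_path a b @` `[0, 1].

Lemma segment_sub a b : segment a b `<=` segment b a.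
Proof.
move=> _ [t /= t01 <-]; exists (1 - t) => /=; last first.
  by rewrite /segment_path scalerBl scale1r -scalerN opprB addrA subrKC.
by move: t01; rewrite !in_itv/= => /andP[? ?]; apply/andP; split; lra.
Qed.

Lemma segmentC a b : segment a b = segment b a.
Proof. by apply/seteqP; split; exact: segment_sub. Qed.

Lemma segment_is_arc a b : a != b -> is_arc (segment a b) a b.
Proof.
move=> ab; exists (segment_path a b); split=> //.
- apply: continuous_subspaceT => t.
  by apply: cvgD; [exact: cvg_cst | apply: cvgZr_tmp; exact: cvg_id].
- move=> s t _ _ /addrI/eqP; rewrite -subr_eq0 -scalerBl scaler_eq0 subr_eq0.
  by rewrite (subr_eq0 b) eq_sym [b == a]eq_sym (negbTE ab) orbF => /eqP.
- by rewrite /segment_path scale0r addr0.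
- by rewrite /segment_path scale1r addrC subrK.
Qed.

Lemma orient_segment a b c d t :
  orient a b (segment_path c d t) = (1 - t) * orient a b c + t * orient a b d.
Proof.
case: a b c d => [a1 a2] [b1 b2] [c1 c2] [d1 d2].
by rewrite /orient /segment_path/= /GRing.scale/=; ring.
Qed.

Lemma orient_segment0 a b p : segment a b p -> orient a b p = 0.
Proof. by case=> t _ <-; rewrite orient_segment /orient; ring. Qed.

(** The points of the segment [cd] stay strictly on one side of the line [ab]. *)
Lemma orient_same_side a b c d p : 0 < orient a b c * orient a b d ->
  segment a b p -> ~ segment c d p.
Proof.
move=> side /orient_segment0 pab [t /=]; rewrite in_itv/= => /andP[t0 t1] pE.
move: pab; rewrite -pE orient_segment => E.
move: side E; move: (orient a b c) (orient a b d) => u v uv E.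
have u2 : 0 < u * u.
  by rewrite -expr2 lt0r sqr_ge0 sqrf_eq0 andbT; apply: contraTneq uv => ->; rewrite mul0r ltxx.
have := congr1 ( *%R u) E; rewrite mulrDr mulr0 !(mulrCA u) => E'.
have h1 : 0 <= (1 - t) * (u * u) by rewrite mulr_ge0 ?subr_ge0// ltW.
have h2 : 0 <= t * (u * v) by rewrite mulr_ge0// ltW.
have /eqP : t * (u * v) = 0 by lra.
rewrite mulf_eq0 (gt_eqF uv) orbF => /eqP tE.
by move: E' u2; rewrite tE mul0r addr0 subr0 mul1r => ->; rewrite ltxx.
Qed.

Lemma segment_common_end a b c p : orient a b c != 0 ->
  segment a b p -> segment a c p -> p = a.
Proof.
move=> nz /orient_segment0 pab [t _ pE]; move: pab; rewrite -pE orient_segment.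
have -> : orient a b a = 0 by rewrite /orient; ring.
rewrite mulr0 add0r => /eqP; rewrite mulf_eq0 (negbTE nz) orbF => /eqP->.
by rewrite /segment_path scale0r addr0.
Qed.

Variables (g : sgraph) (pt : g -> R * R).
(** The witnesses [x] and [y] may be exchanged without changing the segment, so this
    is well defined on unordered pairs. *)
Definition segment_arc (E : {set g}) : set (R * R) :=
  [set p | exists x y, E = [set x; y]%SET /\ segment (pt x) (pt y) p].

Hypothesis pt_inj : injective pt.
Hypothesis pt_gen : forall x y z, uniq [:: x; y; z] ->
  orient (pt x) (pt y) (pt z) != 0.
Hypothesis pt_sep : forall x y u v, sedge x y -> sedge u v ->
  uniq [:: x; y; u; v] ->
  0 < orient (pt x) (pt y) (pt u) * orient (pt x) (pt y) (pt v) \/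
  0 < orient (pt u) (pt v) (pt x) * orient (pt u) (pt v) (pt y).

Lemma segment_arcE x y : x != y ->
  segment_arc [set x; y]%SET = segment (pt x) (pt y).
Proof.
move=> xy; apply/seteqP; split=> [p [u [v [E puv]]]|p pxy]; last by exists x, y.
have : x \in [set u; v]%SET by rewrite -E set21.
have : y \in [set u; v]%SET by rewrite -E set22.
rewrite !inE => /orP[]/eqP vE /orP[]/eqP uE; subst => //; rewrite ?eqxx// in xy.
by rewrite segmentC.
Qed.

(** In general position, the only crossings to exclude are those of disjoint edges,
    and [pt_sep] provides a line through one of them that the other one avoids. *)
Lemma straight_line_drawing : plane_drawing pt segment_arc.
Proof.
split=> //.
- move=> x y /sedge_neq xy; rewrite segment_arcE//; apply: segment_is_arc.
  by rewrite (inj_eq pt_inj).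
- move=> x y z /sedge_neq xy; rewrite segment_arcE// => /orient_segment0/eqP.
  have [->|zx] := eqVneq z x; first by left.
  have [->|zy] := eqVneq z y; first by right.
  move=> pz; suff : false by []; apply: contraTT pz => _; apply: pt_gen.
  by rewrite /= !inE negb_or xy ![_ == z]eq_sym zx zy.
have common x y v p : sedge x y -> sedge x v -> y != v ->
    segment (pt x) (pt y) p -> segment (pt x) (pt v) p -> p = pt x.
  move=> /sedge_neq xy /sedge_neq xv yv; apply: segment_common_end.
  by apply: pt_gen; rewrite /= !inE negb_or xy xv yv.
move=> x y u v xy uv neq p; rewrite !segment_arcE ?sedge_neq// => pxy puv.
have yx : sedge y x by rewrite sedge_sym.
have vu : sedge v u by rewrite sedge_sym.
have [xu|xu] := eqVneq x u.
  subst u; exists x; rewrite !set21; split=> //; apply: common pxy puv => //.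
  by apply: contraNneq neq => ->.
have [xv|xv] := eqVneq x v.
  subst v; exists x; rewrite set21 set22; split=> //.
  rewrite segmentC in puv; apply: common pxy puv => //.
  by apply: contraNneq neq => ->; rewrite finset.setUC.
have [yu|yu] := eqVneq y u.
  subst u; exists y; rewrite set21 set22; split=> //.
  by rewrite segmentC in pxy; apply: common pxy puv.
have [yv|yv] := eqVneq y v.
  subst v; exists y; rewrite !set22; split=> //.
  by rewrite segmentC in pxy; rewrite segmentC in puv; apply: common pxy puv.
have [|side|side] := pt_sep xy uv.
- by rewrite /= !inE !negb_or sedge_neq// xu xv yu yv sedge_neq.
- by case: (orient_same_side side pxy).
- by case: (orient_same_side side puv).
Qed.

End StraightLine.

(** Two numbers below 6 are opposite vertices when they differ by 3. *)
Definition octa_adj : rel 'I_6 := fun i j => (i %% 3 != j %% 3)%N.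

Lemma octa_sym : symmetric octa_adj.
Proof. by move=> i j; rewrite /octa_adj eq_sym. Qed.

Lemma octa_irr : irreflexive octa_adj.
Proof. by move=> i; rewrite /octa_adj eqxx. Qed.

Definition octahedron : sgraph := SGraph octa_sym octa_irr.

(** A triangle 0, 1, 2 with a triangle 3, 4, 5 inside it, the vertex [i + 3] being
    close to the middle of the side opposite to [i]. *)
Definition octa_pt (i : nat) : int * int :=
  nth (0, 0) [:: (0, 0); (12, 0); (0, 12); (5, 5); (1, 5); (5, 1)] i.

(** The hypotheses of [straight_line_drawing] for these integral points, in a form
    that can be evaluated. *)
Definition octa_check : bool :=
  let area i j k := orient (octa_pt i) (octa_pt j) (octa_pt k) in
  all (fun i => all (fun j => all (fun k =>
    uniq [:: i; j; k] ==> (area i j k != 0) &&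
    all (fun l =>
      [&& uniq [:: i; j; k; l], (i %% 3 != j %% 3)%N & (k %% 3 != l %% 3)%N] ==>
      (0 < area i j k * area i j l) || (0 < area k l i * area k l j))
  (iota 0 6)) (iota 0 6)) (iota 0 6)) (iota 0 6).

Lemma octa_check_true : octa_check.
Proof. by vm_compute. Qed.

Lemma octahedron_planar (R : realType) : planar R octahedron.
Proof.
pose pt (i : octahedron) : R * R := let p := octa_pt (nat_of_ord i) in (p.1%:~R, p.2%:~R).
have orientE (i j k : octahedron) : orient (pt i) (pt j) (pt k) =
    (orient (octa_pt (nat_of_ord i)) (octa_pt (nat_of_ord j)) (octa_pt (nat_of_ord k)))%:~R.
  by rewrite /orient /pt/= !(rmorphB, rmorphM).
have iota6 (i : octahedron) : nat_of_ord i \in iota 0 6.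
  by rewrite mem_iota ltn_ord.
have uniqE (s : seq octahedron) : uniq s = uniq (map (@nat_of_ord 6) s).
  by rewrite (map_inj_uniq (@ord_inj 6)).
exists pt, (segment_arc pt); apply: straight_line_drawing.
- move=> i j [] /intr_inj e1 /intr_inj e2; apply/ord_inj/eqP.
  suff : all (fun i => all (fun j => (octa_pt i == octa_pt j) ==> (i == j)) (iota 0 6)) (iota 0 6).
    move=> /allP/(_ _ (iota6 i))/allP/(_ _ (iota6 j))/implyP; apply.
    by rewrite -pair_eqE/= e1 e2 !eqxx.
  by vm_compute.
- move=> i j k; rewrite uniqE orientE intr_eq0 => ijk.
  move: octa_check_true => /allP/(_ _ (iota6 i))/allP/(_ _ (iota6 j)).
  by move=> /allP/(_ _ (iota6 k))/implyP/(_ ijk)/andP[].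
- move=> i j k l ij kl; rewrite uniqE !orientE -!intrM !ltr0z => ijkl.
  have ijk : uniq (map (@nat_of_ord 6) [:: i; j; k]).
    have := ijkl.
    rewrite -[map _ _]/(rcons (map (@nat_of_ord 6) [:: i; j; k]) (nat_of_ord l)).
    by rewrite rcons_uniq => /andP[].
  move: octa_check_true => /allP/(_ _ (iota6 i))/allP/(_ _ (iota6 j)).
  move=> /allP/(_ _ (iota6 k))/implyP/(_ ijk)/andP[_ /allP/(_ _ (iota6 l))/implyP sep].
  by apply/orP/sep/and3P.
Qed.

End PlaneGraphs.

Module EngelGroups.
Import boolp.
Set Implicit Arguments.
Unset Strict Implicit.
Unset Printing Implicit Defensive.
Local Open Scope group_scope.

(** * Sylow subgroups of odd order *)

Section NonNormalSylow.
Variable gT : finGroupType.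
Implicit Types (x y s : gT) (S : {set gT}) (G P Q R : {group gT}).

(** Adjacency between elements of the group itself; it forces both of them to be
    vertices of the Engel graph, by [engel_adjacent_vertex]. *)
Definition engel_adjacent x y := forall k, 0 < k ->
  engel_comm x y k <> 1 /\ engel_comm y x k <> 1.

Definition K33_free G := forall A B : {set gT}, A \subset G -> B \subset G ->
  2 < #|A| -> 2 < #|B| -> ~ {in A & B, forall x y, engel_adjacent x y}.

Definition K5_free G := forall A : {set gT}, A \subset G -> 4 < #|A| ->
  ~ {in A &, forall x y, x != y -> engel_adjacent x y}.

(** The iterated commutators are trapped in [S]. *)
Lemma engel_comm_neq1 S x y : 1 \notin S -> [~ x, y] \in S ->
  {in S, forall s, [~ s, y] \in S} -> forall k, 0 < k -> engel_comm x y k <> 1.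
Proof.
move=> S1 Sxy Sy k k0; suff Sk : engel_comm x y k \in S.
  by move=> e; rewrite e (negbTE S1) in Sk.
by case: k k0 => // k _; elim: k => [|k IH] //=; apply: Sy.
Qed.

Lemma max_Sylow_meet p G P0 Q0 : P0 \in 'Syl_p(G) -> Q0 \in 'Syl_p(G) -> P0 :!=: Q0 ->
  exists P Q, [/\ P \in 'Syl_p(G), Q \in 'Syl_p(G), P :!=: Q &
    forall P' Q', P' \in 'Syl_p(G) -> Q' \in 'Syl_p(G) -> P' :!=: Q' ->
      #|P' :&: Q'| <= #|P :&: Q|].
Proof.
move=> sP0 sQ0 neq.
pose cond (PQ : {group gT} * {group gT}) :=
  [&& PQ.1 \in 'Syl_p(G), PQ.2 \in 'Syl_p(G) & PQ.1 :!=: PQ.2].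
have c0 : cond (P0, Q0) by apply/and3P.
case: (arg_maxnP (fun PQ : {group gT} * {group gT} => #|PQ.1 :&: PQ.2|) c0).
move=> [P Q] /and3P[/= sP sQ PQ] max; exists P, Q; split=> // P' Q' sP' sQ' PQ'.
by apply: (max (P', Q')); apply/and3P.
Qed.

Section SylowMeet.
Variables (p : nat) (G P Q : {group gT}).
Hypotheses (sP : P \in 'Syl_p(G)) (sQ : Q \in 'Syl_p(G)) (neqPQ : P :!=: Q).
Hypothesis maxPQ : forall P' Q', P' \in 'Syl_p(G) -> Q' \in 'Syl_p(G) ->
  P' :!=: Q' -> #|P' :&: Q'| <= #|P :&: Q|.
Local Notation D := (P :&: Q).
Local Notation M := ('N_G(D)).

Let pD : p.-group D.
Proof. by move: sP; rewrite inE => /pHall_pgroup; apply: pgroupS; exact: subsetIl. Qed.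

Let sDG : D \subset G.
Proof. by move: sP; rewrite inE => /pHall_sub; apply: subset_trans; exact: subsetIl. Qed.

Let nDM : D <| M.
Proof. by rewrite normal_subnorm. Qed.

Lemma meet_sub_Sylow R : R \in 'Syl_p(M) -> D \subset R.
Proof.
rewrite inE => sR; apply: subset_trans (pcore_sub_Hall sR).
exact: pcore_max.
Qed.

(** Distinct Sylow subgroups of [M] extend to distinct Sylow subgroups of [G], whose
    intersection is not larger than [D]. *)
Lemma Sylow_norm_meet R1 R2 : R1 \in 'Syl_p(M) -> R2 \in 'Syl_p(M) ->
  R1 :!=: R2 -> R1 :&: R2 = D.
Proof.
move=> s1 s2 neq; apply/esym/eqP.
rewrite eqEcard subsetI !meet_sub_Sylow//=.
move: s1 s2; rewrite !inE => s1 s2.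
have [P1 sP1 RP1] := Sylow_superset (subset_trans (pHall_sub s1) (subsetIl _ _)) (pHall_pgroup s1).
have [P2 sP2 RP2] := Sylow_superset (subset_trans (pHall_sub s2) (subsetIl _ _)) (pHall_pgroup s2).
apply: leq_trans (subset_leq_card (setISS RP1 RP2)) _.
apply: maxPQ; rewrite ?inE//; apply: contraNneq neq => eP.
have capM (R T : {group gT}) : p.-Sylow(M) R -> p.-Sylow(G) T -> R \subset T -> T :&: M = R.
  move=> sR sT RT; apply: (sub_pHall sR).
  - by apply: pgroupS (pHall_pgroup sT); exact: subsetIl.
  - by rewrite subsetI RT (pHall_sub sR).
  - exact: subsetIr.
by rewrite -(capM _ _ s1 sP1 RP1) eP (capM _ _ s2 sP2 RP2).
Qed.

(** Normalizers grow in [p]-groups, so a single Sylow subgroup of [M] would extend to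
    a Sylow subgroup of [G] meeting both [P] and [Q] in more than [D]. *)
Lemma Sylow_norm_meet_neq : exists R1 R2,
  [/\ R1 \in 'Syl_p(M), R2 \in 'Syl_p(M) & R1 :!=: R2].
Proof.
have grow (P' Q' : {group gT}) : P' \in 'Syl_p(G) -> Q' \in 'Syl_p(G) -> P' :!=: Q' ->
    D = P' :&: Q' -> D \proper 'N_P'(D).
  rewrite !inE => sP' sQ' neq E.
  suff prop : D \proper P'.
    exact: nilpotent_proper_norm (pgroup_nil (pHall_pgroup sP')) prop.
  rewrite E properEneq subsetIl andbT; apply: contraNneq neq => /setIidPl sP'Q'.
  by rewrite eqEcard sP'Q' (card_Hall sP') (card_Hall sQ') leqnn.
have PD := grow P Q sP sQ neqPQ erefl.
have QD : D \proper 'N_Q(D).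
  by apply: (grow Q P sQ sP); [rewrite eq_sym | rewrite setIC].
move: sP sQ; rewrite !inE => sP' sQ'.
have sub (S : {group gT}) : p.-Sylow(G) S -> 'N_S(D) \subset M /\ p.-group 'N_S(D).
  move=> sS; split; first by apply: setSI; exact: pHall_sub sS.
  by apply: pgroupS (pHall_pgroup sS); exact: subsetIl.
have [[P1 P2] [Q1 Q2]] := (sub _ sP', sub _ sQ').
have [R1 sR1 PR1] := Sylow_superset P1 P2.
have [R2 sR2 QR2] := Sylow_superset Q1 Q2.
exists R1, R2; rewrite !inE; split=> //; apply: contraNneq neqPQ => eR.
have [S sS RS] := Sylow_superset (subset_trans (pHall_sub sR1) (subsetIl _ _)) (pHall_pgroup sR1).
have same (T : {group gT}) : p.-Sylow(G) T -> D \proper 'N_T(D) -> 'N_T(D) \subset R1 -> T :=: S.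
  move=> sT TD TR; apply/eqP; apply/idPn => neq.
  have := @maxPQ T S; rewrite !inE => /(_ sT sS neq).
  rewrite leqNgt => /negP; apply; apply: leq_trans (proper_card TD) _.
  by rewrite subset_leq_card// subsetI subsetIl (subset_trans TR RS).
have eP := same P sP' PD PR1.
have eQ : Q :=: S by apply: (same Q sQ' QD); rewrite eR.
by apply/eqP; exact: etrans eP (esym eQ).
Qed.

Lemma norm_Sylow_notin R1 R2 x : R1 \in 'Syl_p(M) -> R2 \in 'Syl_p(M) ->
  R1 :!=: R2 -> x \in R1 -> x \notin D -> x \in M :\: 'N_M(R2).
Proof.
move=> s1 s2 neq xR1 xD.
have xR2 : x \notin R2.
  by apply: contra xD => xR2; rewrite -(Sylow_norm_meet s1 s2 neq) inE xR1.
rewrite inE in s1; rewrite inE in s2.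
have xM := subsetP (pHall_sub s1) _ xR1; rewrite in_setD xM andbT.
apply: contraNN xR2 => xN.
have sR2N : p.-Sylow('N_M(R2)) R2.
  by apply: (pHall_subl _ _ s2); [rewrite subsetI (pHall_sub s2) normG | exact: subsetIl].
rewrite (mem_normal_Hall sR2N) ?normal_subnorm ?(pHall_sub s2)//.
exact: mem_p_elt (pHall_pgroup s1) xR1.
Qed.

(** The trap is [M :\: 'N_M(R2)].  Since [[~ s, y] = (y ^ s)^-1 * y], if
    [[~ s, y]] normalizes [R2] then so does [y ^ s], which therefore lies in [R2];
    when [s] does not normalize [R2], this places [y] in two distinct Sylow
    subgroups of [M], hence in [D]. *)
Lemma Sylow_norm_engel R1 R2 x y k : R1 \in 'Syl_p(M) -> R2 \in 'Syl_p(M) ->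
  R1 :!=: R2 -> x \in R1 -> x \notin D -> y \in R2 -> y \notin D -> 0 < k ->
  engel_comm x y k <> 1.
Proof.
move=> s1 s2 neq xR1 xD yR2 yD k0.
have sR2 : p.-Sylow(M) R2 by rewrite inE in s2.
have yM := subsetP (pHall_sub sR2) _ yR2.
have yN : y \in 'N_M(R2) by rewrite inE yM (subsetP (normG R2)).
suff step s : s \in M :\: 'N_M(R2) -> [~ s, y] \in M :\: 'N_M(R2).
  apply: (@engel_comm_neq1 (M :\: 'N_M(R2))) => //; first by rewrite in_setD group1.
  exact/step/(norm_Sylow_notin s1 s2).
rewrite in_setD => /andP[sN sM]; rewrite in_setD; apply/andP; split; last exact: groupR.
apply: contraNN sN => sy.
have ysN : y ^ s \in 'N_M(R2).
  by move: sy; rewrite commgEr groupMr// conjVg groupV.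
have sR2N : p.-Sylow('N_M(R2)) R2.
  by apply: (pHall_subl _ _ sR2); [rewrite subsetI (pHall_sub sR2) normG | exact: subsetIl].
have ysR2 : y ^ s \in R2.
  rewrite (mem_normal_Hall sR2N) ?normal_subnorm ?(pHall_sub sR2)//.
  by rewrite p_eltJ (mem_p_elt (pHall_pgroup sR2)).
rewrite inE sM/=; apply: contraNT yD => sNR2.
have s3 : (R2 :^ s^-1)%G \in 'Syl_p(M) by rewrite inE pHallJ// groupV.
rewrite -(Sylow_norm_meet s3 s2) ?inE ?yR2 ?mem_conjgV ?ysR2//.
by apply: contraNneq sNR2 => e; rewrite -groupV inE e.
Qed.

End SylowMeet.

(** Let [M] be the normalizer of a largest intersection [D] of two Sylow subgroups.
    The number of its Sylow [p]-subgroups is congruent to 1 modulo [p] and larger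
    than 1, hence at least 4; two of them are used for each side of a K33. *)
Lemma K33_free_Sylow_normal p G P :
  K33_free G -> prime p -> odd p -> P \in 'Syl_p(G) -> P <| G.
Proof.
move=> free p_pr oddp sP0.
have sPG : P \subset G by move: sP0; rewrite inE => /pHall_sub.
rewrite /normal sPG /=; apply/subsetP => g gG; apply/idPn => gN.
have sP1 : (P :^ g)%G \in 'Syl_p(G) by move: sP0; rewrite !inE pHallJ.
have neq0 : P :!=: (P :^ g)%G by apply: contraNneq gN => e; rewrite inE -e.
have [P1 [Q [sP1' sQ neq max]]] := max_Sylow_meet sP0 sP1 neq0.
set D := P1 :&: Q in max; set M := 'N_G(D).
have adj (R1 R2 : {group gT}) : R1 \in 'Syl_p(M) -> R2 \in 'Syl_p(M) -> R1 :!=: R2 ->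
    {in R1 :\: D & R2 :\: D, forall x y, engel_adjacent x y}.
  move=> s1 s2 neq12 x y; rewrite !in_setD => /andP[xD xR] /andP[yD yR] k k0.
  split; first exact: (Sylow_norm_engel sP1' max s1 s2 neq12 xR xD yR yD k0).
  by apply: (Sylow_norm_engel sP1' max s2 s1 _ yR yD xR xD k0); rewrite eq_sym.
have big (R : {group gT}) : R \in 'Syl_p(M) -> 2 <= #|R :\: D|.
  move=> sR; have DR : D \subset R := meet_sub_Sylow sP1' sR.
  have [Ra [Rb [sa sb nab]]] := Sylow_norm_meet_neq sP1' sQ neq max.
  have ltDR : #|D| < #|R|.
    rewrite ltn_neqAle subset_leq_card// andbT; apply: contraNneq nab => eDR.
    have eqD (S : {group gT}) : S \in 'Syl_p(M) -> D = S.
      move=> sS; apply/eqP; rewrite eqEcard (meet_sub_Sylow sP1' sS) eDR.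
      by move: sS sR; rewrite !inE => /card_Hall-> /card_Hall->; rewrite leqnn.
    exact/eqP/(etrans (esym (eqD _ sa)) (eqD _ sb)).
  have oddR : odd #|R|.
    move: sR; rewrite inE => /pHall_pgroup/card_pgroup->.
    by rewrite oddX oddp orbT.
  have oddD : odd #|D| := dvdn_odd (@cardSg _ R (P1 :&: Q)%G DR) oddR.
  rewrite cardsD (setIidPr DR).
  have : ~~ odd (#|R| - #|D|) by rewrite oddB ?oddR ?oddD// ltnW.
  by move: ltDR; rewrite -subn_gt0; case: (_ - _) => [|[]].
have four : exists R1 R2 R3 R4 : {group gT}, [/\ R1 \in 'Syl_p(M), R2 \in 'Syl_p(M),
   R3 \in 'Syl_p(M) & R4 \in 'Syl_p(M)] /\ [/\ R1 :!=: R2, R3 :!=: R4,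
   (R1 :!=: R3) && (R1 :!=: R4) & (R2 :!=: R3) && (R2 :!=: R4)].
  have [Ra [Rb [sa sb nab]]] := Sylow_norm_meet_neq sP1' sQ neq max.
  have card4 : 3 < #|'Syl_p(M)|.
    have modE := card_Syl_mod M p_pr.
    have n1 : 1 < #|'Syl_p(M)| by apply/card_gt1P; exists Ra, Rb.
    have p3 : 2 < p by apply: odd_prime_gt2.
    move: n1; rewrite (divn_eq #|_| p) modE.
    case: (_ %/ p) => [|q _]; first by rewrite mul0n.
    rewrite mulSn addn1 ltnS.
    exact: leq_trans p3 (leq_addr _ _).
  have [R4 s4] : exists R4, R4 \in 'Syl_p(M) by exists Ra.
  have : 2 < #|'Syl_p(M) :\ R4| by rewrite (cardsD1 R4) s4 in card4.
  move=> /card_gt2P[R1 [R2 [R3 []]]]; rewrite !in_setD1.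
  move=> [/andP[n14 s1] /andP[n24 s2] /andP[n34 s3]] [n12 n23 n31].
  exists R1, R2, R3, R4; split; split=> //; apply/andP; split=> //.
  by rewrite eq_sym.
have [R1 [R2 [R3 [R4 [[s1 s2 s3 s4] [n12 n34 /andP[n13 n14] /andP[n23 n24]]]]]]] := four.
have sub (R : {group gT}) : R \in 'Syl_p(M) -> R :\: D \subset G.
  rewrite inE => /pHall_sub RM; apply: subset_trans (subsetDl _ _) _.
  exact: subset_trans RM (subsetIl _ _).
have card2 (S T : {group gT}) : S \in 'Syl_p(M) -> T \in 'Syl_p(M) -> S :!=: T ->
    2 < #|(S :\: D) :|: (T :\: D)|.
  move=> sS sT ST; rewrite cardsU -setDIl (Sylow_norm_meet sP1' max sS sT ST) setDv cards0 subn0.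
  exact: leq_trans (leq_add (big _ sS) (big _ sT)).
apply: (free ((R1 :\: D) :|: (R2 :\: D)) ((R3 :\: D) :|: (R4 :\: D))).
- by rewrite subUset !sub.
- by rewrite subUset !sub.
- exact: card2.
- exact: card2.
- move=> x y /setUP[]xR /setUP[]yR.
  + exact: (adj R1 R3).
  + exact: (adj R1 R4).
  + exact: (adj R2 R3).
  + exact: (adj R2 R4).
Qed.

End NonNormalSylow.

(** * Adjacency from an element acting on a subgroup *)

Section Action.
Variable gT : finGroupType.
Implicit Types (x y z s : gT) (S : {set gT}) (G H X D : {group gT}).

Lemma engel_adjacentI S x y : 1 \notin S -> [~ x, y] \in S -> [~ y, x] \in S ->
  {in S, forall s, [~ s, x] \in S /\ [~ s, y] \in S} -> engel_adjacent x y.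
Proof.
move=> S1 Sxy Syx St k k0; split; apply: engel_comm_neq1 k0; try eassumption.
- by move=> s /St[].
- by move=> s /St[].
Qed.

(** If [u = [~ s, z]] commutes with [z], then [z * u^-1], a conjugate of [z], has the
    order of [z], so the order of [u] divides both [#[z]] and [#|H|]. *)
Lemma coprime_comm2_eq1 H z s : z \in 'N(H) -> coprime #|H| #[z] -> s \in H ->
  commute [~ s, z] z -> [~ s, z] = 1.
Proof.
move=> nHz co sH cuz; set u := [~ s, z]; rewrite -/u in cuz.
have uH : u \in H by rewrite /u commgEl groupM ?groupV// memJ_norm.
have zs : z ^ s = z * u^-1 by rewrite invg_comm commgEl mulgA mulgV mul1g.
have czu : commute z u^-1 by apply/commuteV/commute_sym.
apply/eqP; rewrite -invg_eq1 -order_eq1 -dvdn1.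
have un : u^-1 ^+ #[z] = 1.
  have := expgMn #[z] czu; rewrite -zs expg_order mul1g => <-.
  by rewrite -conjXg expg_order conj1g.
by rewrite -(eqP co) dvdn_gcd order_dvdG ?groupV//= order_dvdn un.
Qed.

(** The trap for commutators with a conjugate [y] of [z] is [H :\: 'C[y]], by
    [coprime_comm2_eq1]. *)
Lemma coprime_class_engel H z : z \in 'N(H) -> coprime #|H| #[z] ->
  {in z ^: H &, forall x y, x != y -> engel_adjacent x y}.
Proof.
move=> nHz co.
have one x y k : x \in z ^: H -> y \in z ^: H -> x != y -> 0 < k -> engel_comm x y k <> 1.
  case/imsetP=> a aH -> /imsetP[b bH ->] neq.
  set y' := z ^ b.
  have nHy : y' \in 'N(H) by rewrite groupJ// (subsetP (normG H)).
  have coy : coprime #|H| #[y'] by rewrite orderJ.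
  have step s : s \in H :\: 'C[y'] -> [~ s, y'] \in H :\: 'C[y'].
    rewrite !in_setD => /andP[sC sH].
    have -> : [~ s, y'] \in H by rewrite commgEl groupM ?groupV// memJ_norm.
    rewrite andbT; apply: contra sC => /cent1P cs; apply/cent1P/commgP.
    exact/eqP/(coprime_comm2_eq1 nHy coy sH).
  set c := b^-1 * a; have cH : c \in H by rewrite groupM ?groupV.
  have zc : z ^ a = y' ^ c by rewrite /y' -conjgM /c mulgA mulgV mul1g.
  have cS : c \in H :\: 'C[y'].
    rewrite in_setD cH andbT; apply: contra neq => /cent1P cc.
    by rewrite zc conjgE -cc mulKg.
  apply: (@engel_comm_neq1 _ (H :\: 'C[y'])) => //; first by rewrite in_setD group1.
  have -> : [~ z ^ a, y'] = [~ [~ c, y']^-1, y'].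
    by rewrite zc conjg_mulR commMgJ commgg conj1g mul1g invg_comm.
  by apply: (step); rewrite in_setD !groupV -in_setD; apply: (step).
by move=> x y xz yz neq k k0; split; apply: one; rewrite // eq_sym.
Qed.

Lemma K5_free_coprime_index G H z : K5_free G -> H \subset G -> z \in G ->
  z \in 'N(H) -> coprime #|H| #[z] -> #|H : 'C_H[z]| <= 4.
Proof.
move=> free HG zG nHz co; rewrite index_cent1 leqNgt; apply/negP => lt4.
apply: (free (z ^: H)) => //; last exact: coprime_class_engel.
by apply: subset_trans (class_subG zG HG) _.
Qed.

(** The trap is [X :\: D].  Modulo [D] the action of [z * a] on [X] is that of [z],
    and [z * b] differs from [z * a] by the element [a^-1 * b] of [X]. *)
Lemma coset_engel_adjacent X D z a b : D <| X -> z \in 'N(X) -> z \in 'N(D) ->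
  X^`(1) \subset D -> {in X :\: D, forall s, [~ s, z] \notin D} ->
  a \in X -> b \in X -> a^-1 * b \notin D -> engel_adjacent (z * a) (z * b).
Proof.
case/andP=> sDX nDX nXz nDz X'D fpf aX bX abD.
have good c s : c \in X -> s \in X :\: D -> [~ s, z * c] \in X :\: D.
  move=> cX sS; have := sS; rewrite !in_setD => /andP[sD sX].
  rewrite commgMJ.
  have scD : [~ s, c] \in D by apply: (subsetP X'D); rewrite mem_commg.
  have szX : [~ s, z] \in X by rewrite commgEl groupM ?groupV// memJ_norm.
  rewrite groupMl// memJ_norm ?(subsetP nDX)// fpf//.
  by rewrite groupM ?groupR// groupJ.
set c := a^-1 * b in abD.
have cS : c \in X :\: D by rewrite in_setD abD groupM ?groupV.
have zb : z * b = (z * a) * c by rewrite /c !mulgA mulgK.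
have cx : [~ c, z * a] \in X :\: D by exact: good.
apply: (@engel_adjacentI (X :\: D)).
- by rewrite in_setD group1.
- by rewrite zb commgMJ commgg conj1g mulg1 -invg_comm in_setD !groupV -in_setD.
- by rewrite zb commMgJ commgg conj1g mul1g.
- by move=> s sS; split; apply: good.
Qed.

(** The cosets [z D] and [z c D], with [c] in [X] but not in [D], are the two sides of
    a complete bipartite graph. *)
Lemma K33_free_fpf_kernel G X D z : K33_free G -> X \subset G -> z \in G -> D \proper X ->
  D <| X -> z \in 'N(X) -> z \in 'N(D) ->
  X^`(1) \subset D -> {in X :\: D, forall s, [~ s, z] \notin D} -> #|D| <= 2.
Proof.
move=> free XG zG /properP[sDX [c cX cD]] nsDX nXz nDz X'D fpf.
rewrite leqNgt; apply/negP => D3.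
apply: (free (z *: D) (z *: (c *: D))); rewrite ?card_lcoset//.
- by rewrite mul_subG ?sub1set// (subset_trans sDX).
- by rewrite mul_subG ?sub1set// mul_subG ?sub1set ?(subsetP XG)// (subset_trans sDX).
- move=> _ _ /lcosetP[d dD ->] /lcosetP[_ /lcosetP[e eD ->] ->].
  apply: (coset_engel_adjacent nsDX) => //.
  + exact: subsetP dD.
  + by rewrite groupM// (subsetP sDX).
  + by rewrite groupMl ?groupV// groupMr.
Qed.

End Action.

(** * Groups whose Engel graph contains neither K33 nor K5 *)

(** The relations of the dihedral group of order [2n] for [k = 0], and those of the
    dicyclic group of that order for [2k = n]. *)
Definition dihedral_like (gT : finGroupType) (G : {group gT}) n k (x y : gT) :=
  [/\ <[x]> <*> <[y]> = G, x ^+ n = 1, y ^+ 2 = x ^+ k & x ^ y = x^-1].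

Section ForbiddenSubgraphs.
Variable gT : finGroupType.
Implicit Types (x y z : gT) (G H P : {group gT}).

Lemma K33_freeS G H : H \subset G -> K33_free G -> K33_free H.
Proof.
by move=> HG free A B AH BH; apply: free; [exact: subset_trans AH _|exact: subset_trans BH _].
Qed.

(** Every Sylow subgroup for an odd prime is normal, hence contained in the core. *)
Lemma K33_free_pcore_Hall G : K33_free G -> 2^'.-Hall(G) 'O_2^'(G).
Proof.
move=> free; rewrite /pHall pcore_sub pcore_pgroup /= pnatNK.
apply/pnatP => [|q q_pr qd]; first exact: indexg_gt0.
rewrite inE /=; have [//|oddq] := even_prime q_pr; first by move->.
have [P sP] := Sylow_exists q G.
have nP : P <| G by apply: (K33_free_Sylow_normal free q_pr oddq); rewrite inE.
have PO : P \subset 'O_2^'(G).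
  apply: pcore_max => //; apply: sub_in_pnat (pHall_pgroup sP) => p _.
  by rewrite !inE => /eqP->; apply: contraTneq oddq => ->.
case/and3P: sP => _ _; rewrite p'natE// => /negP[].
exact: dvdn_trans qd (indexgS G PO).
Qed.

Lemma K33_free_odd_nil H : K33_free H -> odd #|H| -> nilpotent H.
Proof.
move=> free oddH.
apply: nilpotentS (Fitting_nil H); rewrite -{1}(Sylow_gen H) gen_subG.
apply/bigcupsP => P /SylowP[p p_pr sP].
have [-> | ntP] := eqVneq P 1%G; first exact: sub1G.
apply: Fitting_max (pgroup_nil (pHall_pgroup sP)).
apply: (K33_free_Sylow_normal free p_pr); last by rewrite inE.
have [_ pP _] := pgroup_pdiv (pHall_pgroup sP) ntP.
exact: dvdn_odd (dvdn_trans pP (cardSg (pHall_sub sP))) oddH.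
Qed.

Section Structure.
Variable G : {group gT}.
Hypotheses (free33 : K33_free G) (free5 : K5_free G) (nnil : ~~ nilpotent G).
Local Notation H := 'O_2^'(G).

Let oddH : odd #|H|.
Proof. by rewrite odd_2'nat; exact: pcore_pgroup. Qed.

Variable Q : {group gT}.
Hypothesis sylQ : 2.-Sylow(G) Q.

Let defG : H ><| Q = G.
Proof. exact/(sdprod_Hall_p'coreP (K33_free_pcore_Hall free33)). Qed.

Lemma Sylow2_acts : exists2 z, z \in Q & z \notin 'C(H).
Proof.
apply/subsetPn; apply: contraNN nnil => QC.
have [_ <- _ _] := sdprodP defG.
rewrite mulg_nil// (K33_free_odd_nil (K33_freeS (pcore_sub _ _) free33))//=.
exact: pgroup_nil (pHall_pgroup sylQ).
Qed.

Variable z : gT.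
Hypotheses (zQ : z \in Q) (nCz : z \notin 'C(H)).
Let zG : z \in G. Proof. exact: subsetP (pHall_sub sylQ) _ zQ. Qed.

Let nHz : z \in 'N(H). Proof. exact: subsetP (gFnorm _ _) _ zG. Qed.

Let coHz : coprime #|H| #[z].
Proof.
rewrite coprime_sym; apply: (@p'nat_coprime 2^'); last exact: pcore_pgroup.
by rewrite pnatNK; exact: mem_p_elt (pHall_pgroup sylQ) zQ.
Qed.

(** The class of [z] under [H] is a clique of odd size, larger than 1 and at most 4. *)
Lemma index_odd_cent : #|H : 'C_H[z]| = 3.
Proof.
have := K5_free_coprime_index free5 (pcore_sub _ _) zG nHz coHz.
have : odd #|H : 'C_H[z]| by apply: dvdn_odd oddH; exact: dvdn_indexg.
have : #|H : 'C_H[z]| != 1%N.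
  rewrite indexg_eq1; apply: contra nCz => /subsetIP[_].
  by rewrite sub_cent1.
by case: #|_ : _| => [|[|[|[|[]]]]].
Qed.

(** The centralizer of [z] in [H] has prime index in a nilpotent group, hence is
    normal; by [coprime_comm2_eq1], [z] has no fixed point on the quotient, so
    [K33_free_fpf_kernel] bounds the centralizer, whose order is odd. *)
Lemma card_odd_core : #|H| = 3.
Proof.
have idx := index_odd_cent.
have ltCH : 'C_H[z] \proper H.
  by rewrite properE subsetIl -indexg_eq1 idx.
have nilH := K33_free_odd_nil (K33_freeS (pcore_sub _ _) free33) oddH.
have nCH : 'C_H[z] <| H.
  have ltCN := nilpotent_proper_norm nilH ltCH.
  rewrite -[X in _ <| X](_ : 'N_H('C_H[z]) = H); first by rewrite normal_subnorm subsetIl.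
  apply/eqP; rewrite eqEsubset subsetIl/= -indexg_eq1.
  have := Lagrange_index (subsetIl H 'N('C_H[z])) (proper_sub ltCN).
  rewrite idx; have := indexg_gt1 'N_H('C_H[z]) 'C_H[z].
  rewrite proper_subn//.
  move: #|'N_H('C_H[z]) : _| #|H : _| => [|[|b]] [|[|a]] //= _; rewrite ?muln0//.
  by rewrite !mulSn !addSn !addnS.
have cent_fpf : {in H :\: 'C_H[z], forall s, [~ s, z] \notin 'C_H[z]}.
  move=> s; rewrite in_setD => /andP[sC sH]; apply: contra sC => /setIP[_ /cent1P cs].
  rewrite inE sH; apply/cent1P/commgP/eqP.
  exact: coprime_comm2_eq1 nHz coHz sH cs.
have nCz' : z \in 'N('C_H[z]).
  by rewrite -cycle_subG normsI// cycle_subG// (subsetP (normG _))// cent1id.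
have der : H^`(1) \subset 'C_H[z].
  apply: der1_min (normal_norm nCH) _; apply: cyclic_abelian; apply: prime_cyclic.
  by rewrite card_quotient ?normal_norm// idx.
have le2 := K33_free_fpf_kernel free33 (pcore_sub _ _) zG ltCH nCH nHz nCz' der cent_fpf.
have := Lagrange (proper_sub ltCH); rewrite idx => cH.
have : odd #|'C_H[z]| by apply: dvdn_odd oddH; rewrite -cH dvdn_mulr.
by move: le2 cH; case: #|'C_H[z]| => [|[|[]]] //= _ <-.
Qed.

Local Notation D := 'C_Q(H).

Let abH : abelian H.
Proof. by apply: cyclic_abelian; apply: prime_cyclic; rewrite card_odd_core. Qed.

Let sHX : H \subset 'C_G(H).
Proof. by rewrite subsetI pcore_sub. Qed.

Let pD : 2.-group D.
Proof. by apply: pgroupS (pHall_pgroup sylQ); exact: subsetIl. Qed.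

Let tiHD : H :&: D = 1.
Proof.
apply: coprime_TIg; rewrite coprime_sym; apply: (@p'nat_coprime 2^').
  by rewrite pnatNK.
exact: pcore_pgroup.
Qed.

Let sDX : D \subset 'C_G(H).
Proof. by apply: setSI; exact: pHall_sub sylQ. Qed.

Let mulHD : H * D = 'C_G(H).
Proof. by rewrite group_modl// (sdprodW defG). Qed.

Let nsDX : D <| 'C_G(H).
Proof.
rewrite /normal sDX -mulHD mul_subG ?normG//.
by apply: subset_trans (cent_sub _); rewrite centsC subsetIr.
Qed.

Let nDz : z \in 'N(D).
Proof.
rewrite -cycle_subG normsI ?norms_cent ?cycle_subG//.
exact: (subsetP (normG Q)).
Qed.

(** The centralizer of [H] is the direct product of [H] and [D], and [z] has no fixed
    point on the quotient by [D], which is a copy of [H]. *)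
Lemma card_Sylow2_cent : #|D| <= 2.
Proof.
apply: (K33_free_fpf_kernel free33 (subsetIl _ _) zG _ nsDX (X := 'C_G(H)%G)) => //.
- rewrite properE sDX /=; apply/negP => sXD.
  have := card_odd_core; suff -> : H = 1 by rewrite cards1.
  by apply/trivgP; rewrite -tiHD subsetI subxx (subset_trans sHX).
- by rewrite -cycle_subG normsI ?norms_cent ?cycle_subG// (subsetP (normG G)).
- apply: der1_min (normal_norm nsDX) _.
  suff : abelian ('C_G(H) / D) by [].
  by rewrite -mulHD quotientMidr; exact: quotient_abelian.
move=> s; rewrite in_setD => /andP[sD sX].
have /mulsgP[h d hH dD sE] : s \in H * D by rewrite mulHD.
have dC : d \in 'C(H) by case/setIP: dD.
have dzD : [~ d, z] \in D by rewrite commgEl groupM ?groupV// memJ_norm.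
have hzH : [~ h, z] \in H by rewrite commgEl groupM ?groupV// memJ_norm.
rewrite sE commMgJ groupMr// memJ_norm; last by apply: subsetP (normG _) _ _.
apply: contra sD => hzD.
have : [~ h, z] \in H :&: D by rewrite inE hzH.
rewrite tiHD => /set1P/eqP/commgP hC.
have : h \in 'C_H[z] by rewrite inE hH; apply/cent1P.
have/eqP := Lagrange (subsetIl H 'C[z]); rewrite index_odd_cent card_odd_core.
rewrite -[X in _ == X]mul1n eqn_pmul2r// -trivg_card1 => /eqP-> /set1P h1.
by rewrite sE h1 mul1g.
Qed.

Lemma odd_core_generator : exists2 h, h != 1 & H = <[h]>.
Proof.
have /cyclicP[h hE] : cyclic H by apply: prime_cyclic; rewrite card_odd_core.
exists h => //; apply: contra_eq_neq card_odd_core => h1.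
by rewrite hE h1 cycle1 cards1.
Qed.

Lemma Sylow2_inverts h : H = <[h]> -> h ^ z = h^-1.
Proof.
move=> hE; have oh : #[h] = 3 by rewrite orderE -hE card_odd_core.
have : h ^ z \in <[h]> by rewrite -hE memJ_norm// hE cycle_id.
case/cyclePmin=> i; rewrite oh; case: i => [|[|[|]]] // _ hz.
- by move/eqP: hz; rewrite expg0 conjg_eq1 => /eqP h1; rewrite h1 order1 in oh.
- case/negP: nCz; rewrite hE cent_cycle; apply/cent1P/commute_sym/commgP/conjg_fixP.
  by rewrite hz expg1.
- by rewrite hz; apply/esym/eqP; rewrite eq_invg_mul -expgS -order_dvdn oh.
Qed.

(** A generator of [H] has only two possible conjugates. *)
Lemma card_centralizer_index : #|G : 'C_G(H)| = 2.
Proof.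
have [h h1 hE] := odd_core_generator.
have [le2 ge2] : #|G : 'C_G(H)| <= 2 /\ 1 < #|G : 'C_G(H)|.
  split; last by rewrite indexg_gt1; apply: contra nCz => /subsetIP[_ /subsetP]; exact.
  rewrite {1}hE cent_cycle index_cent1.
  have oH : #|H^#| = 2 by have := card_odd_core; rewrite (cardsD1 1) group1 => -[].
  rewrite -oH subset_leq_card//.
  apply/subsetP=> _ /imsetP[g gG ->]; rewrite !inE conjg_eq1 h1.
  by rewrite memJ_norm ?(subsetP (gFnorm _ _))// hE cycle_id.
by apply/eqP; rewrite eqn_leq le2.
Qed.

Lemma card_centralizer : #|'C_G(H)| = (3 * #|D|)%N.
Proof. by rewrite -mulHD TI_cardMg// card_odd_core. Qed.

Lemma generated_by_centralizer (J : {group gT}) : J \subset G -> z \in J ->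
  H \subset J -> D \subset J -> J :=: G.
Proof.
move=> JG zJ HJ DJ; apply/eqP; rewrite eqEsubset JG/= -indexg_eq1.
have XJ : 'C_G(H) \subset J by rewrite -mulHD mul_subG.
have := Lagrange_index JG XJ; rewrite card_centralizer_index.
have : 1 < #|J : 'C_G(H)|.
  rewrite indexg_gt1; apply: contra nCz => /subsetP/(_ z zJ).
  by case/setIP.
move: #|J : _| #|G : _| => [|[|b]] [|[|a]] //= _; rewrite ?muln0//.
by rewrite !mulSn !addSn !addnS.
Qed.

(** When [D] has order 2, generated by [d], the element [h * d] of order 6 plays the
    role of [x]; then [x ^+ 3 = d], and [z ^+ 2] is 1 or [d].  When [D] is trivial,
    [x] is [h] itself. *)
Lemma sylow2_structure_generators : exists n k x y,
  [/\ dihedral_like G n k x y, #|G| = n.*2 & (n, k) \in [:: (3, 0); (6, 0); (6, 3)]].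
Proof.
have [h h1 hE] := odd_core_generator.
have hz := Sylow2_inverts hE.
have oh : #[h] = 3 by rewrite orderE -hE card_odd_core.
have cardG : #|G| = (3 * #|D|).*2.
  rewrite -card_centralizer -muln2.
  by have := Lagrange (subsetIl G 'C(H)); rewrite card_centralizer_index => <-.
have z2D : z ^+ 2 \in D.
  rewrite inE groupX//= hE cent_cycle; apply/cent1P/commute_sym/commgP/conjg_fixP.
  by rewrite expgS expg1 conjgM hz conjVg hz invgK.
have hG : h \in G by rewrite (subsetP (pcore_sub 2^' G))// hE cycle_id.
have := card_Sylow2_cent; rewrite leq_eqVlt => /orP[/eqP D2|Dlt2].
  have /cyclicP[d dE] : cyclic D by apply: prime_cyclic; rewrite D2.
  have dD : d \in D by rewrite dE cycle_id.
  have dG : d \in G by apply: subsetP dD; exact: subset_trans sDX (subsetIl _ _).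
  have od : #[d] = 2 by rewrite orderE -dE D2.
  have chd : commute h d.
    by apply/commute_sym/(centP (subsetP (subsetIr Q 'C(H)) _ dD)); rewrite hE cycle_id.
  have dz : d ^ z = d.
    have : d ^ z \in D by rewrite memJ_norm.
    rewrite dE; case/cyclePmin=> i; rewrite od; case: i => [|[|]] // _ e.
    by move/eqP: e; rewrite expg0 conjg_eq1 => /eqP d1; rewrite d1 order1 in od.
  have dd : d * d = 1 by rewrite -(expg_order d) od.
  have x3 : (h * d) ^+ 3 = d.
    by rewrite expgMn// -{1}oh expg_order mul1g !expgS expg0 mulg1 dd mulg1.
  have x4 : (h * d) ^+ 4 = h.
    by rewrite expgSr x3 mulgA -chd -mulgA dd mulg1.
  exists 6, (if z ^+ 2 == 1 then 0 else 3), (h * d), z; split; last by case: ifP.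
  - split.
    + apply: generated_by_centralizer.
      * by rewrite join_subG !cycle_subG groupM.
      * by rewrite mem_gen// inE cycle_id orbT.
      * by rewrite hE cycle_subG -[X in X \in _]x4 groupX// mem_gen// inE cycle_id.
      * by rewrite dE cycle_subG -[X in X \in _]x3 groupX// mem_gen// inE cycle_id.
    + by rewrite (expgM _ 3 2) x3 -od expg_order.
    + case: ifP => [/eqP->//|/eqP z2]; rewrite x3.
      move: z2D; rewrite dE => /cyclePmin[i]; rewrite od; case: i => [|[|]] // _ //.
    + rewrite conjMg hz dz [h * d]chd invMg; congr (_ * _).
      by apply/esym/eqP; rewrite eq_invg_mul dd.
  - by rewrite cardG D2.
have D1 : D = 1.
  by apply/eqP; rewrite trivg_card1 eqn_leq cardG_gt0 andbT.
exists 3, 0, h, z; split=> //; last by rewrite cardG D1 cards1.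
split=> //.
- apply: generated_by_centralizer.
  + by rewrite join_subG !cycle_subG hG.
  + by rewrite mem_gen// inE cycle_id orbT.
  + by rewrite hE cycle_subG mem_gen// inE cycle_id.
  + by rewrite D1 sub1G.
- by rewrite -oh expg_order.
- by move: z2D; rewrite D1 => /set1P->.
Qed.

End Structure.

Lemma free_nonnilpotent_structure G : K33_free G -> K5_free G -> ~~ nilpotent G ->
  exists n k x y,
  [/\ dihedral_like G n k x y, #|G| = n.*2 & (n, k) \in [:: (3, 0); (6, 0); (6, 3)]].
Proof.
move=> f3 f5 nnil; have [Q sQ] := Sylow_exists 2 G.
have [z zQ zC] := Sylow2_acts f3 nnil sQ.
exact: (sylow2_structure_generators f3 f5 sQ (z:=z)).
Qed.

End ForbiddenSubgraphs.

(** * Recognizing the three groups *)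

Section Dihedral.
Implicit Types (gT rT : finGroupType).

(** Even powers of [y] belong to [<[x]>]. *)
Lemma dihedral_like_cosets gT (G : {group gT}) n k x y :
  dihedral_like G n k x y -> G \subset <[x]> :|: <[x]> :* y.
Proof.
case=> defG _ y2 xy.
have nxy : <[y]> \subset 'N(<[x]>) by rewrite norms_cycle xy groupV cycle_id.
rewrite -defG norm_joinEr//; apply/subsetP => _ /mulsgP[a _ aX /cycleP[j ->] ->].
have -> : y ^+ j = y ^+ 2 ^+ j./2 * y ^+ odd j.
  by rewrite -expgM -expgD mul2n addnC odd_double_half.
have bX : a * y ^+ 2 ^+ j./2 \in <[x]> by rewrite groupM// y2 -expgM mem_cycle.
rewrite mulgA inE; case: (odd j); last by rewrite expg0 mulg1 bX.
by rewrite expg1 mem_rcoset mulgK bX orbT.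
Qed.

Lemma dihedral_like_card gT (G : {group gT}) n k x y : 0 < n ->
  dihedral_like G n k x y -> #|G| <= n.*2.
Proof.
move=> n0 dG; apply: leq_trans (subset_leq_card (dihedral_like_cosets dG)) _.
apply: leq_trans (leq_card_setU _ _) _; rewrite card_rcoset addnn leq_double -orderE.
by apply: dvdn_leq => //; rewrite order_dvdn; case: dG => _ ->.
Qed.

Lemma dihedral_like_morphim gT rT (D G : {group gT}) (f : {morphism D >-> rT}) n k x y :
  G \subset D -> dihedral_like G n k x y -> dihedral_like (f @* G) n k (f x) (f y).
Proof.
move=> GD [defG xn y2 xy].
have xD : x \in D by rewrite (subsetP GD)// -defG mem_gen// inE cycle_id.
have yD : y \in D by rewrite (subsetP GD)// -defG mem_gen// inE cycle_id orbT.
split.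
- by rewrite -!morphim_cycle// -morphimY ?cycle_subG// defG.
- by rewrite -morphX// xn morph1.
- by rewrite -!morphX// y2.
- by rewrite -morphJ// xy morphV.
Qed.

Lemma dihedral_like_homg_image gT rT (G : {group gT}) (H : {group rT}) n k x y :
  G \homg H -> dihedral_like H n k x y -> exists x' y', dihedral_like G n k x' y'.
Proof.
case/homgP=> f fH /(dihedral_like_morphim f (subxx H)) [defG xn y2 xy].
by exists (f x), (f y); split=> //; rewrite defG; exact: fH.
Qed.

(** The pairs [(x, x')] and [(y, y')] generate a subgroup of the direct product that
    satisfies the same relations, so it has at most [2n] elements; as it projects
    onto [G], it is isomorphic to [G], and it also projects onto [H]. *)
Lemma dihedral_like_homg gT rT (G : {group gT}) (H : {group rT}) n k x y x' y' :
  0 < n -> #|G| = n.*2 -> dihedral_like G n k x y -> dihedral_like H n k x' y' ->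
  H \homg G.
Proof.
move=> n0 cG dG dH; have [defG xn y2 xy] := dG; have [defH x'n y'2 x'y'] := dH.
pose u := (x, x'); pose v := (y, y'); pose K := (<[u]> <*> <[v]>)%G.
have pairX m a b : (a, b) ^+ m = (a ^+ m, b ^+ m) :> gT * rT.
  by elim: m => // m IH; rewrite !expgS IH.
have dK : dihedral_like K n k u v.
  split=> //; first by rewrite pairX xn x'n.
    by rewrite !pairX y2 y'2.
  have -> : u ^ v = (x ^ y, x' ^ y') by [].
  by rewrite xy x'y'.
have homGK : G \homg K.
  have [def1 _ _ _] := dihedral_like_morphim (fst_morphism gT rT) (subsetT K) dK.
  have -> : G :=: fst_morphism gT rT @* K by rewrite -defG -def1.
  exact: morphim_homg (subsetT _).
have homHK : H \homg K.
  have [def2 _ _ _] := dihedral_like_morphim (snd_morphism gT rT) (subsetT K) dK.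
  have -> : H :=: snd_morphism gT rT @* K by rewrite -defH -def2.
  exact: morphim_homg (subsetT _).
have isoGK : G \isog K by rewrite isogEcard homGK cG (dihedral_like_card n0 dK).
by rewrite (eq_homgr _ isoGK).
Qed.

Lemma dihedral_like_isog gT rT (G : {group gT}) (H : {group rT}) n k x y x' y' :
  0 < n -> #|G| = n.*2 -> #|H| = n.*2 ->
  dihedral_like G n k x y -> dihedral_like H n k x' y' -> G \isog H.
Proof.
move=> n0 cG cH dG dH; rewrite isogEhom.
by rewrite (dihedral_like_homg n0 cG dG dH) (dihedral_like_homg n0 cH dH dG).
Qed.

Lemma Grp_dihedral_like0 gT (G : {group gT}) :
  (G \homg Grp (s : r : s ^+ 6, r ^+ 2, s ^ r * s)) <->
  exists x y, dihedral_like G 6 0 x y.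
Proof.
split=> [/existsP[[x y]] /=|[x [y [defG x6 y2 xy]]]].
  rewrite !xpair_eqE -(eq_invg_mul (x ^ y)) => /and4P[/eqP defG /eqP x6 /eqP y2 /eqP xy].
  by exists x, y; split=> //; apply: invg_inj; rewrite xy invgK.
apply/existsP; exists (x, y); rewrite /= !xpair_eqE -(eq_invg_mul (x ^ y)).
by rewrite defG x6 y2 xy invgK !eqxx.
Qed.

Lemma Grp_dihedral_like3 gT (G : {group gT}) :
  (G \homg Grp (x : y : x ^+ 6, x ^+ 3 * y ^- 2, x ^ y * x)) <->
  exists x y, dihedral_like G 6 3 x y.
Proof.
split=> [/existsP[[x y]] /=|[x [y [defG x6 y2 xy]]]].
  rewrite !xpair_eqE -(eq_invg_mul (x ^ y)) -eq_mulgV1.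
  move=> /and4P[/eqP defG /eqP x6 /eqP y2 /eqP xy].
  by exists x, y; split=> //; apply: invg_inj; rewrite xy invgK.
apply/existsP; exists (x, y); rewrite /= !xpair_eqE -(eq_invg_mul (x ^ y)) -eq_mulgV1.
by rewrite defG x6 y2 xy invgK !eqxx.
Qed.

(** Generators are the product of the two adjacent transpositions [s] and [t] and [s]
    itself; the order of the product comes from the braid relation. *)
Lemma S3_dihedral_like : exists x y : 'S_3, dihedral_like [set: 'S_3]%G 3 0 x y.
Proof.
pose o0 : 'I_3 := @Ordinal 3 0 isT; pose o1 : 'I_3 := @Ordinal 3 1 isT.
pose o2 : 'I_3 := @Ordinal 3 2 isT.
pose s := tperm o0 o1; pose t := tperm o1 o2.
have s2 : s * s = 1 by exact: tperm2.
have t2 : t * t = 1 by exact: tperm2.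
have sV : s^-1 = s by exact: tpermV.
have tV : t^-1 = t by exact: tpermV.
have braid : s ^ t = t ^ s.
  by rewrite !tpermJ tpermL tpermR !tpermD.
have sts : t * s * t = s * t * s by move: braid; rewrite !conjgE sV tV !mulgA.
have x3 : (s * t) ^+ 3 = 1.
  have -> : (s * t) ^+ 3 = s * (t * s * t) * (s * t).
    by rewrite !expgS expg0 mulg1 !mulgA.
  by rewrite sts !mulgA s2 mul1g -(mulgA t s s) s2 mulg1.
have s1 : s != 1 by apply/eqP => /permP/(_ o0); rewrite tpermL perm1.
have st1 : s * t != 1.
  by rewrite -eq_invg_mul sV; apply/eqP => /permP/(_ o0); rewrite tpermL tpermD.
exists (s * t), s; split=> //; last by rewrite conjgE mulgA invMg sV tV (mulgA s s) s2 mul1g.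
apply/eqP; rewrite eqEcard subsetT /= cardsT card_Sn.
set K := _ <*> _.
have sK : s \in K by rewrite mem_gen// inE cycle_id orbT.
have stK : s * t \in K by rewrite mem_gen// inE cycle_id.
have os : #[s] = 2 by apply: nt_prime_order; rewrite // expgS expg1.
have ost : #[s * t] = 3 by apply: nt_prime_order.
have := order_dvdG sK; have := order_dvdG stK; rewrite os ost => d3 d2.
by apply: dvdn_leq => //; rewrite (@Gauss_dvd 2 3)// d2.
Qed.

Lemma isog_S3_dihedral_like gT (G : {group gT}) :
  G \isog [set: 'S_3] <-> #|G| = 6 /\ exists x y, dihedral_like G 3 0 x y.
Proof.
have [s [t dS]] := S3_dihedral_like.
have cS : #|[set: 'S_3]| = 6 by rewrite cardsT card_Sn.
split=> [iso|[cG [x [y dG]]]].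
  split; first by rewrite (card_isog iso).
  exact: dihedral_like_homg_image (isog_hom iso) dS.
exact: (@dihedral_like_isog _ _ _ _ 3 0 _ _ _ _ isT cG cS dG dS).
Qed.

Lemma isoGrp_dihedral_like0 gT (G : {group gT}) x y :
  #|G| = 12 -> dihedral_like G 6 0 x y ->
  G \isog Grp (s : r : s ^+ 6, r ^+ 2, s ^ r * s).
Proof.
move=> cG dG; apply: intro_isoGrp; first by apply/Grp_dihedral_like0; exists x, y.
move=> rT H /Grp_dihedral_like0[x' [y' dH]].
exact: (dihedral_like_homg (n := 6) isT cG dG dH).
Qed.

Lemma isoGrp_dihedral_like3 gT (G : {group gT}) x y :
  #|G| = 12 -> dihedral_like G 6 3 x y ->
  G \isog Grp (x : y : x ^+ 6, x ^+ 3 * y ^- 2, x ^ y * x).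
Proof.
move=> cG dG; apply: intro_isoGrp; first by apply/Grp_dihedral_like3; exists x, y.
move=> rT H /Grp_dihedral_like3[x' [y' dH]].
exact: (dihedral_like_homg (n := 6) isT cG dG dH).
Qed.

End Dihedral.

(** * Engel graphs *)

(** Iterated commutators descend along the lower central series. *)
Lemma nilpotent_engel (gT : finGroupType) (G : {group gT}) :
  nilpotent G -> engel_group G.
Proof.
move=> /lcnP[n Ln]; apply/setP => x; rewrite inE; case xG : (x \in G) => //=.
apply/asboolP => a aG; exists n.+1; split=> //; apply/set1P.
suff lcn k : engel_comm a x k \in 'L_k.+1(G).
  have := lcn n.+1; rewrite lcnSn Ln comm1G; exact.
elim: k => [|k IH] /=; first by rewrite lcn1.
by rewrite lcnSn mem_commg.
Qed.

Section Vertices.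
Variables (gT : finGroupType) (G : {group gT}).

Lemma engel_adjacent_vertex x y : x \in G -> y \in G -> engel_adjacent x y ->
  x \in G :\: left_engel_set G.
Proof.
move=> xG yG adj; rewrite !inE xG andbT /=; apply/asboolP => /(_ y yG)[k [k0 e]].
by case: (adj k k0).
Qed.

Lemma engel_graph_edge (u v : engel_graph G) :
  engel_adjacent (val u) (val v) -> sedge u v.
Proof.
move=> adj; apply/andP; split; last exact/asboolP.
by apply/eqP => e; have [] := adj 1%N isT; rewrite e /= commgg.
Qed.

Lemma planar_K33_free (R : realType) : planar R (engel_graph G) -> K33_free G.
Proof.
move=> pl A B AG BG A3 B3 adj.
have [a0 a0A] : exists a, a \in A by apply/set0Pn; rewrite -card_gt0 ltnW// ltnW.
have [b0 b0B] : exists b, b \in B by apply/set0Pn; rewrite -card_gt0 ltnW// ltnW.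
have symadj x y : engel_adjacent x y -> engel_adjacent y x.
  by move=> h k /h[].
have vA a : a \in A -> a \in G :\: left_engel_set G.
  move=> aA; apply: (engel_adjacent_vertex (subsetP AG _ aA) (subsetP BG _ b0B)).
  exact: adj.
have vB b : b \in B -> b \in G :\: left_engel_set G.
  move=> bB; apply: (engel_adjacent_vertex (subsetP BG _ bB) (subsetP AG _ a0A)).
  exact/symadj/adj.
pose ea (i : 'I_3) := enum_val (widen_ord A3 i).
pose eb (i : 'I_3) := enum_val (widen_ord B3 i).
have eaA i : ea i \in A := enum_valP _.
have ebB i : eb i \in B := enum_valP _.
pose a (i : 'I_3) : engel_graph G := exist _ (ea i) (vA _ (eaA i)).
pose b (i : 'I_3) : engel_graph G := exist _ (eb i) (vB _ (ebB i)).
apply: (@PlaneGraphs.K33_nonplanar R (engel_graph G) a b) => //.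
- move=> i j /(congr1 val)/= /enum_val_inj/(congr1 (fun k : 'I__ => k : nat)) ij.
  exact: val_inj.
- move=> i j /(congr1 val)/= /enum_val_inj/(congr1 (fun k : 'I__ => k : nat)) ij.
  exact: val_inj.
- by move=> i j; apply: engel_graph_edge; exact: adj _ _ (eaA i) (ebB j).
Qed.

Lemma planar_K5_free (R : realType) : planar R (engel_graph G) -> K5_free G.
Proof.
move=> pl A AG A5 adj.
have vA a : a \in A -> a \in G :\: left_engel_set G.
  move=> aA; have : 0 < #|A :\ a| by move: A5; rewrite (cardsD1 a) aA; case: #|_|.
  rewrite card_gt0 => /set0Pn[b /setD1P[ba bA]].
  apply: (engel_adjacent_vertex (subsetP AG _ aA) (subsetP AG _ bA)).
  by apply: adj; rewrite // eq_sym.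
pose ea (i : 'I_5) := enum_val (widen_ord A5 i).
have eaA i : ea i \in A := enum_valP _.
pose a (i : 'I_5) : engel_graph G := exist _ (ea i) (vA _ (eaA i)).
apply: (@PlaneGraphs.K5_nonplanar R (engel_graph G) a) => // i j ij.
apply: engel_graph_edge; apply: (adj _ _ (eaA i) (eaA j)).
apply: contraNneq ij => /enum_val_inj/(congr1 (fun k : 'I__ => k : nat)) ij.
exact/eqP/val_inj.
Qed.

(** The elements of the abelian normal subgroup [<[x]>] are left Engel, so each vertex
    is [x ^+ i * y] for some [i < 6]; when [i] and [j] are congruent modulo 3,
    [x ^+ i * y] and [x ^+ j * y] commute, because [x ^+ 3] commutes with [x] and
    [y]. *)
Lemma dihedral_like_planar (R : realType) k x y :
  dihedral_like G 6 k x y -> planar R (engel_graph G).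
Proof.
move=> dG; have [defG x6 y2 xy] := dG.
have xG : x \in G by rewrite -defG mem_gen// inE cycle_id.
have nsXG : <[x]> <| G.
  rewrite /normal cycle_subG xG -defG join_subG normG /=.
  by rewrite norms_cycle xy groupV cycle_id.
have engX g : g \in <[x]> -> g \in left_engel_set G.
  move=> gX; rewrite inE (subsetP (normal_sub nsXG))//=.
  apply/asboolP => a aG; exists 2; split=> //=.
  have agX : [~ a, g] \in <[x]>.
    by rewrite commgEr groupMr// conjVg groupV memJ_norm// (subsetP (normal_norm nsXG)).
  by apply/eqP/commgP; apply: (centsP (cycle_abelian x)).
have vertexE (u : engel_graph G) : exists i : 'I_6, val u = x ^+ i * y.
  have := valP u; rewrite /= in_setD => /andP[uL uG].
  have := subsetP (dihedral_like_cosets dG) _ uG.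
  rewrite inE => /orP[/engX uX|]; first by rewrite uX in uL.
  rewrite mem_rcoset => /cycleP[m me].
  exists (Ordinal (ltn_pmod m (isT : 0 < 6))); rewrite /= -(mulgKV y (val u)) me.
  by rewrite {1}(divn_eq m 6) mulnC expgD expgM x6 expg1n mul1g.
have /choice[f fE] := vertexE.
apply: (@PlaneGraphs.planar_mono R (engel_graph G) PlaneGraphs.octahedron f _ _
  (PlaneGraphs.octahedron_planar R)).
  by move=> u v e; apply: val_inj; rewrite !fE e.
move=> u v /andP[_ /asboolP adj]; apply/negP => /eqP mod3.
have [+ _] := adj 1%N isT; apply => /=; apply/eqP/commgP.
have x3y : commute (x ^+ 3) y.
  apply/commgP/conjg_fixP; rewrite conjXg xy expgVn; apply/eqP.
  by rewrite eq_invg_mul -expgD x6.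
(* Modulo powers of x ^+ 3, the factor x ^+ i only depends on i modulo 3. *)
have split3 i : x ^+ i = x ^+ 3 ^+ (i %/ 3) * x ^+ (i %% 3).
  by rewrite -expgM -expgD mulnC -divn_eq.
rewrite !fE (split3 (f u)) (split3 (f v)) mod3 -!mulgA; set w := _ * y.
have cw m : commute w (x ^+ 3 ^+ m).
  apply/commute_sym/commuteM; first by rewrite -expgM; exact: commuteX2.
  exact/commute_sym/commuteX/commute_sym.
apply: commuteM; apply/commute_sym/commuteM; rewrite ?commute_refl//.
  exact: commuteX2.
exact/commute_sym/cw.
Qed.

End Vertices.

Lemma planar_engel_graph_isog (R : realType) (gT : finGroupType) (G : {group gT}) :
  ~ engel_group G -> planar R (engel_graph G) ->
  [\/ G \isog [set: 'S_3],
      G \isog Grp (s : r : s ^+ 6, r ^+ 2, s ^ r * s)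
    | G \isog Grp (x : y : x ^+ 6, x ^+ 3 * y ^- 2, x ^ y * x)].
Proof.
move=> hG pl.
have nnil : ~~ nilpotent G by apply/negP => /nilpotent_engel.
have [n [k [x [y [dG cG]]]]] := free_nonnilpotent_structure (planar_K33_free pl)
  (planar_K5_free pl) nnil.
rewrite !inE => /or3P[]/eqP[nE kE]; subst n k.
- by apply: Or31; apply/isog_S3_dihedral_like; split=> //; exists x, y.
- by apply: Or32; exact: isoGrp_dihedral_like0 cG dG.
- by apply: Or33; exact: isoGrp_dihedral_like3 cG dG.
Qed.

Lemma isog_planar_engel_graph (R : realType) (gT : finGroupType) (G : {group gT}) :
  [\/ G \isog [set: 'S_3],
      G \isog Grp (s : r : s ^+ 6, r ^+ 2, s ^ r * s)
    | G \isog Grp (x : y : x ^+ 6, x ^+ 3 * y ^- 2, x ^ y * x)] ->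
  planar R (engel_graph G).
Proof.
case=> [/isog_S3_dihedral_like[_ [x [y [defG x3 y2 xy]]]]|iso|iso].
- apply: (@dihedral_like_planar _ _ R 0 x y); split=> //.
  by rewrite (expgM x 3 2) x3 expg1n.
- have /Grp_dihedral_like0[x [y dG]] := isoGrp_hom iso.
  exact: dihedral_like_planar dG.
- have /Grp_dihedral_like3[x [y dG]] := isoGrp_hom iso.
  exact: dihedral_like_planar dG.
Qed.

End EngelGroups.

Theorem theorem3p1 (R : realType) (gT : finGroupType) (G : {group gT})
    (hG : ~ engel_group G) :
  planar R (engel_graph G) <->
  [\/ (G \isog [set: 'S_3])%g,
      (G \isog Grp (s : r : s ^+ 6, r ^+ 2, s ^ r * s))%g
    | (G \isog Grp (x : y : x ^+ 6, x ^+ 3 * y ^- 2, x ^ y * x))%g].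
Proof.
split; first exact: EngelGroups.planar_engel_graph_isog.
exact: EngelGroups.isog_planar_engel_graph.
Qed.
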